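(* Let $q$ be a prime power and let $L$ be a line of $\mathrm{PG}(5,q)$ in the $K$-orbit $o_{12,1}$. Then the hyperplane-orbit distribution $OD_4(L)$ is $\left[q+2,\,q^2+\frac{q-1}{2},\,q^2-\frac{q+1}{2},\,q^3-q^2\right]$ if $q$ is odd, and $\left[q^2+q+1,\,\frac{q^2+q}{2},\,\frac{q^2-q}{2},\,q^3-q^2\right]$ if $q$ is even.
   Context: A point $(y_0,\dots,y_5)$ of $\mathrm{PG}(5,q)$ is identified with the nonzero symmetric matrix $\begin{bmatrix} y_0&y_1&y_2\\ y_1&y_3&y_4\\ y_2&y_4&y_5\end{bmatrix}$ up to scalar. $K\cong\mathrm{PGL}(3,q)$ acts by $M\mapsto AMA^T$, $A\in\mathrm{GL}(3,q)$. The orbit $o_{12,1}$ is the $K$-orbit of the line $\left\{\begin{bmatrix} 0&x&0\\ x&0&y\\ 0&y&0\end{bmatrix}:(x,y)\in\mathrm{PG}(1,q)\right\}$. Hyperplanes correspond to conics of $\mathrm{PG}(2,q)$ (nonzero quadratic forms up to scalar): $\sum_{0\le i\le j\le2}a_{ij}X_iX_j$ corresponds to $a_{00}Y_0+a_{01}Y_1+a_{02}Y_2+a_{11}Y_3+a_{12}Y_4+a_{22}Y_5=0$. $\mathcal H_1,\mathcal H_{2,r},\mathcal H_{2,i},\mathcal H_3$ are the sets of hyperplanes corresponding respectively to double lines (scalar multiples of squares of linear forms), pairs of distinct real lines (products of two non-proportional linear forms over $\mathbb F_q$), pairs of conjugate imaginary lines (scalar multiples of products of two non-proportional linear forms conjugate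 over $\mathbb F_{q^2}$), and non-singular conics (those with $4a_{00}a_{11}a_{22}+a_{01}a_{02}a_{12}-a_{00}a_{12}^2-a_{11}a_{02}^2-a_{22}a_{01}^2\ne0$). $OD_4(L)=[h_1,h_{2,r},h_{2,i},h_3]$ lists the numbers of hyperplanes in $\mathcal H_1,\mathcal H_{2,r},\mathcal H_{2,i},\mathcal H_3$ containing $L$. *)

(* Defs.v *)
From HB Require Import structures.
From mathcomp Require Import all_boot all_order all_fingroup all_algebra all_field.
From mathcomp Require Import mpoly.

Set Implicit Arguments.
Unset Strict Implicit.
Unset Printing Implicit Defensive.

Import GRing.Theory.
Local Open Scope ring_scope.

(* PG(5,q) is the lattice of subspaces of 'rV[F]_6 with q = #|F|: points, lines
   and hyperplanes are the subspaces of dimension 1, 2 and 5. *)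

Section FiniteSubspaces.
Import VectorInternalTheory.
Variables (F : finFieldType) (vT : vectType F).
HB.instance Definition _ := [Countable of {vspace vT} by <:].
HB.instance Definition _ := [Finite of {vspace vT} by <:].
End FiniteSubspaces.

(* The k-th coordinate y_k is the entry in position (idx_row k, idx_col k), the
   pairs being 00, 01, 02, 11, 12, 22; idx is the inverse numbering, extended
   symmetrically. *)
Definition idx_row (k : 'I_6) : 'I_3 :=
  inord (nth 0 [:: 0; 0; 0; 1; 1; 2] k)%N.
Definition idx_col (k : 'I_6) : 'I_3 :=
  inord (nth 0 [:: 0; 1; 2; 1; 2; 2] k)%N.
Definition idx (i j : 'I_3) : 'I_6 :=
  inord (nth 0 (nth [::] [:: [:: 0; 1; 2];
                             [:: 1; 3; 4];
                             [:: 2; 4; 5]] i) j)%N.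

Lemma idxK (k : 'I_6) : idx (idx_row k) (idx_col k) = k.
Proof.
apply/val_inj; case: k => [] [|[|[|[|[|[|//]]]]]] ? /=;
  by rewrite /idx /idx_row /idx_col /= !inordK /= ?inordK.
Qed.

Lemma idxC (i j : 'I_3) : idx i j = idx j i.
Proof. by case: i j => [] [|[|[|//]]] ? [] [|[|[|//]]] ?. Qed.

Section Plane.
Variable F : finFieldType.

Definition sym_of (y : 'rV[F]_6) : 'M[F]_3 := \matrix_(i, j) y 0 (idx i j).
Definition coord_of (M : 'M[F]_3) : 'rV[F]_6 :=
  \row_k M (idx_row k) (idx_col k).

Lemma sym_of_sym y : (sym_of y)^T = sym_of y.
Proof. by apply/matrixP=> i j; rewrite !mxE idxC. Qed.

Lemma sym_ofK : cancel sym_of coord_of.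
Proof. by move=> y; apply/rowP=> k; rewrite !mxE idxK. Qed.

Lemma coord_ofK (M : 'M[F]_3) : M^T = M -> sym_of (coord_of M) = M.
Proof.
move=> sM; have sME i j : M i j = M j i by rewrite -{1}sM mxE.
apply/matrixP=> i j; rewrite !mxE.
case: i j => [] [|[|[|//]]] ? [] [|[|[|//]]] ?;
  rewrite /idx /idx_row /idx_col /= !inordK //=;
  first [by congr (M _ _); apply/val_inj; rewrite /= inordK
        |by rewrite sME; congr (M _ _); apply/val_inj; rewrite /= inordK].
Qed.

(* M |-> A M A^T in coordinates; the group K is induced by the invertible A. *)
Definition congr_act (A : 'M[F]_3) (y : 'rV[F]_6) : 'rV[F]_6 :=
  coord_of (A *m sym_of y *m A^T).

Fact congr_act_is_linear A : linear (congr_act A).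
Proof.
move=> c u v; rewrite /congr_act.
have -> : sym_of (c *: u + v) = c *: sym_of u + sym_of v.
  by apply/matrixP=> i j; rewrite !mxE.
rewrite mulmxDr mulmxDl -scalemxAr -scalemxAl.
by apply/rowP=> k; rewrite !mxE.
Qed.

HB.instance Definition _ A :=
  GRing.isLinear.Build F 'rV[F]_6 'rV[F]_6 _ (congr_act A)
    (congr_act_is_linear A).

Definition line12_1 : {vspace 'rV[F]_6} :=
  (<[(delta_mx 0 (idx 0 1))%R]> + <[(delta_mx 0 (idx 1 2))%R]>)%VS.

Lemma mem_line12_1 v :
  reflect (exists x y : F,
             sym_of v = \matrix_(i < 3, j < 3)
               nth 0 (nth [::] [:: [:: 0; x; 0];
                                   [:: x; 0; y];
                                   [:: 0; y; 0]] i) j)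
          (v \in line12_1).
Proof.
apply: (iffP memv_addP) => [[u /vlineP[x ->]] [w /vlineP[y ->]] ->|[x [y e]]].
  exists x, y; apply/matrixP=> i j; rewrite !mxE eqxx /= -!val_eqE.
  case: i j => [] [|[|[|//]]] ? [] [|[|[|//]]] ?;
    by rewrite /= !inordK //= ?mulr0 ?mulr1 ?addr0 ?add0r.
exists (x *: delta_mx 0 (idx 0 1)); first exact/vlineP/(ex_intro _ x).
exists (y *: delta_mx 0 (idx 1 2)); first exact/vlineP/(ex_intro _ y).
rewrite -[v]sym_ofK e; apply/rowP=> k; rewrite !mxE eqxx /= -!val_eqE.
case: k => [] [|[|[|[|[|[|//]]]]]] ? /=;
  by rewrite /idx_row /idx_col !inordK //= ?mulr0 ?mulr1 ?addr0 ?add0r.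
Qed.

Definition orbit12_1 : {set {vspace 'rV[F]_6}} :=
  [set (linfun (congr_act A) @: line12_1)%VS | A in unitmx].

(* A conic is given by the coefficient vector a of its quadratic form. *)
Definition qform (a : 'rV[F]_6) : {mpoly F[3]} :=
  \sum_(k < 6) a 0 k *: ('X_(idx_row k) * 'X_(idx_col k)).

Definition hyperplane (a : 'rV[F]_6) : {vspace 'rV[F]_6} :=
  lker (linfun (mulmxr a^T)).

Lemma mem_hyperplane a v :
  (v \in hyperplane a) = (\sum_(k < 6) a 0 k * v 0 k == 0).
Proof.
rewrite memv_ker lfunE /=.
have -> : v *m a^T = const_mx (\sum_(k < 6) a 0 k * v 0 k).
  apply/matrixP=> i j; rewrite !ord1 !mxE.
  by apply: eq_bigr => k _; rewrite mxE mulrC.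
apply/eqP/eqP=> [/matrixP/(_ 0 0)|->]; first by rewrite !mxE.
by apply/matrixP=> i j; rewrite !mxE.
Qed.

End Plane.

Definition lform (R : comNzRingType) (b : 'rV[R]_3) : {mpoly R[3]} :=
  \sum_(i < 3) b 0 i *: 'X_i.

Definition proportional (R : finFieldType) (b b' : 'rV[R]_3) : bool :=
  [exists c : R, (b == c *: b') || (b' == c *: b)].

Section Conics.
Variable F : finFieldType.

Definition double_line (f : {mpoly F[3]}) : bool :=
  [exists c : F, [exists b : 'rV[F]_3, f == c *: lform b ^+ 2]].

Definition real_line_pair (f : {mpoly F[3]}) : bool :=
  [exists b : 'rV[F]_3, [exists b' : 'rV[F]_3,
     ~~ proportional b b' && (f == lform b * lform b')]].

(* E stands for GF(q^2), with iota the inclusion of GF(q) = F. *)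
Definition conj_form (E : finFieldType) (b : 'rV[E]_3) : 'rV[E]_3 :=
  map_mx (fun x => x ^+ #|F|) b.

Definition imaginary_line_pair (E : finFieldType) (iota : {rmorphism F -> E})
    (f : {mpoly F[3]}) : bool :=
  [exists c : F, [exists b : 'rV[E]_3,
     ~~ proportional b (conj_form b) &&
     (map_mpoly iota f == iota c *: (lform b * lform (conj_form b)))]].

Definition conic_disc (a : 'rV[F]_6) : F :=
  let a00 := a 0 (idx 0 0) in
  let a01 := a 0 (idx 0 1) in
  let a02 := a 0 (idx 0 2) in
  let a11 := a 0 (idx 1 1) in
  let a12 := a 0 (idx 1 2) in
  let a22 := a 0 (idx 2 2) in
  4%:R * a00 * a11 * a22 + a01 * a02 * a12
  - a00 * a12 ^+ 2 - a11 * a02 ^+ 2 - a22 * a01 ^+ 2.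

Definition H1 : {set {vspace 'rV[F]_6}} :=
  [set hyperplane a | a : 'rV[F]_6 & (a != 0) && double_line (qform a)].

Definition H2r : {set {vspace 'rV[F]_6}} :=
  [set hyperplane a | a : 'rV[F]_6 & (a != 0) && real_line_pair (qform a)].

Definition H2i (E : finFieldType) (iota : {rmorphism F -> E}) :
    {set {vspace 'rV[F]_6}} :=
  [set hyperplane a | a : 'rV[F]_6 &
     (a != 0) && imaginary_line_pair iota (qform a)].

Definition H3 : {set {vspace 'rV[F]_6}} :=
  [set hyperplane a | a : 'rV[F]_6 & (a != 0) && (conic_disc a != 0)].

Definition OD4 (E : finFieldType) (iota : {rmorphism F -> E})
    (L : {vspace 'rV[F]_6}) : seq nat :=
  [seq #|[set h in Hs | (L <= h)%VS]|
     | Hs : {set {vspace 'rV[F]_6}} <- [:: H1; H2r; H2i iota; H3]].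

End Conics.

(* Main.v *)
(* The pairing of a product b b' of linear forms with a point y is b M(y) b'^T, so K
   acts on conics by b -> b A and preserves the four classes; L may be taken to be the
   standard line.  A conic through it is al X0^2 + be X0 X2 + ga X2^2 + e X1^2, with
   discriminant e (4 al ga - be^2); this counts the non-singular conics, and the double
   lines are found directly.  A real line pair has exactly 2(q-1) factorizations into
   linear forms, so the pairs (b, b') are counted instead: either both lines pass through
   (0,1,0), and such pairs correspond to GL(2,q), or q is odd and b' is a multiple of the
   image of b under X1 -> -X1.  Since quadratics over F split in E, every singular conic
   of this shape falls into exactly one of the three degenerate classes, and the imaginary
   pairs are obtained by subtraction. *)
Require Import Defs.
From HB Require Import structures.
From mathcomp Require Import all_boot all_order all_fingroup all_algebra all_field.
From mathcomp Require Import all_solvable.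
From mathcomp Require Import mpoly ring zify.

Set Implicit Arguments.
Unset Strict Implicit.
Unset Printing Implicit Defensive.

Import GRing.Theory.
Local Open Scope ring_scope.

(** * Case analysis and sums over the coordinates of the plane and of PG(5,q) *)

Lemma forall_ord3 (P : 'I_3 -> Prop) : P 0 -> P 1 -> P 2 -> forall i, P i.
Proof.
move=> P0 P1 P2 [[|[|[|//]]] lti].
- by rewrite (_ : Ordinal lti = 0) //; apply: val_inj.
- by rewrite (_ : Ordinal lti = 1) //; apply: val_inj.
- by rewrite (_ : Ordinal lti = 2) //; apply: val_inj.
Qed.

Lemma forall_ord6 (P : 'I_6 -> Prop) :
  P (idx 0 0) -> P (idx 0 1) -> P (idx 0 2) -> P (idx 1 1) -> P (idx 1 2) ->
  P (idx 2 2) -> forall k, P k.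
Proof.
move=> P0 P1 P2 P3 P4 P5 k; rewrite -(idxK k).
move: (idx_row k) (idx_col k); apply: forall_ord3; apply: forall_ord3 => //;
  by rewrite idxC.
Qed.

Lemma val_idx (i j : 'I_3) :
  idx i j = nth 0%N (nth [::] [:: [:: 0; 1; 2];
                             [:: 1; 3; 4];
                             [:: 2; 4; 5]] i) j :> nat.
Proof. by move: i j; apply: forall_ord3; apply: forall_ord3; rewrite inordK. Qed.

Lemma idx_row_idx (i j : 'I_3) : (i <= j)%N -> idx_row (idx i j) = i.
Proof.
move=> le_ij; apply: val_inj; rewrite /idx_row val_idx.
by move: i j le_ij; apply: forall_ord3; apply: forall_ord3 => //=; rewrite inordK.
Qed.

Lemma idx_col_idx (i j : 'I_3) : (i <= j)%N -> idx_col (idx i j) = j.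
Proof.
move=> le_ij; apply: val_inj; rewrite /idx_col val_idx.
by move: i j le_ij; apply: forall_ord3; apply: forall_ord3 => //=; rewrite inordK.
Qed.

Lemma eq_idx (i j i' j' : 'I_3) :
  (idx i j == idx i' j') =
  ((i == i') && (j == j')) || ((i == j') && (j == i')).
Proof.
by rewrite -val_eqE /= !val_idx;
  move: i j i' j'; do 4![apply: forall_ord3].
Qed.

Lemma sum_ord3 (V : nmodType) (G : 'I_3 -> V) : \sum_i G i = G 0 + G 1 + G 2.
Proof.
rewrite !big_ord_recr big_ord0 /= add0r.
by congr (G _ + G _ + G _); apply: val_inj.
Qed.

Lemma sum_ord6 (V : nmodType) (G : 'I_6 -> V) :
  \sum_k G k = G (idx 0 0) + G (idx 0 1) + G (idx 0 2) + G (idx 1 1)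
               + G (idx 1 2) + G (idx 2 2).
Proof.
rewrite !big_ord_recr big_ord0 /= add0r.
by congr (G _ + G _ + G _ + G _ + G _ + G _); apply: val_inj; rewrite /= val_idx.
Qed.

(** * Products of linear forms in coordinates *)

Section ProductOfLinearForms.
Variable R : comNzRingType.

(** Both ordered pairs (i, j) and (j, i) contribute to the entry at [idx i j], so this is the
    coefficient vector of the product of two linear forms. The ring is arbitrary because products
    are taken over [F] and over its extensions. *)
Definition pform (b b' : 'rV[R]_3) : 'rV[R]_6 :=
  \row_k \sum_i \sum_(j | idx i j == k) b 0 i * b' 0 j.

Lemma pformE (b b' : 'rV[R]_3) (i j : 'I_3) :
  pform b b' 0 (idx i j) =
  if i == j then b 0 i * b' 0 i else b 0 i * b' 0 j + b 0 j * b' 0 i.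
Proof.
rewrite mxE; under eq_bigr do rewrite big_mkcond /=.
rewrite !sum_ord3 !eq_idx.
by move: i j; do 2![apply: forall_ord3]; rewrite /= ?(addr0, add0r) // addrC.
Qed.

Lemma pformC (b b' : 'rV[R]_3) : pform b b' = pform b' b.
Proof.
apply/rowP => k; rewrite -(idxK k) !pformE.
by case: eqP => [->|_]; rewrite mulrC // [X in _ + X]mulrC addrC.
Qed.

Lemma pformZl c (b b' : 'rV[R]_3) : pform (c *: b) b' = c *: pform b b'.
Proof.
apply/rowP => k; rewrite -(idxK k) [RHS]mxE !pformE !mxE.
by case: eqP; rewrite ?mulrDr ?mulrA // [b 0 _ * c]mulrC.
Qed.

Lemma pformZr c (b b' : 'rV[R]_3) : pform b (c *: b') = c *: pform b b'.
Proof. by rewrite pformC pformZl pformC. Qed.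

Lemma pformBr (b u v : 'rV[R]_3) : pform b (u - v) = pform b u - pform b v.
Proof.
apply/rowP => k; rewrite -(idxK k) [RHS]mxE [X in _ = _ + X]mxE !pformE !mxE.
by case: eqP => _; ring.
Qed.

(** With M(y) the symmetric matrix of [y], the right-hand side is b M(y) b'^T. [y] is a bare
    function so that it can be a point of PG(5,q) or the products p_i p_j of the coordinates of a
    point of the plane. *)
Lemma sum_pform (b b' : 'rV[R]_3) (y : 'I_6 -> R) :
  \sum_k pform b b' 0 k * y k = \sum_i \sum_j b 0 i * b' 0 j * y (idx i j).
Proof.
under eq_bigr => k _.
  rewrite mxE mulr_suml; under eq_bigr => i _.
    rewrite mulr_suml big_mkcond /=; over.
  over.
rewrite exchange_big /=; apply: eq_bigr => i _.
rewrite exchange_big /=; apply: eq_bigr => j _.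
by rewrite -big_mkcond (big_pred1 (idx i j)) // => k; rewrite eq_sym.
Qed.

End ProductOfLinearForms.

Lemma map_pform (R S : comNzRingType) (f : {rmorphism R -> S}) (b b' : 'rV[R]_3) :
  map_mx f (pform b b') = pform (map_mx f b) (map_mx f b').
Proof.
apply/rowP => k; rewrite -(idxK k) [LHS]mxE !pformE !mxE.
by case: eqP; rewrite ?rmorphD !rmorphM.
Qed.

(** * Quadratic polynomials and their coefficient vectors *)

Section QuadraticForms.
Variable F : finFieldType.

Lemma lformM (b b' : 'rV[F]_3) : lform b * lform b' = qform (pform b b').
Proof.
rewrite /lform /qform !sum_ord3 !sum_ord6 !pformE /= !idx_row_idx // !idx_col_idx //.
rewrite -!mul_mpolyC !mpolyCD !mpolyCM; ring.
Qed.

Lemma qformZ c (a : 'rV[F]_6) : qform (c *: a) = c *: qform a.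
Proof.
by rewrite scaler_sumr; apply: eq_bigr => k _; rewrite mxE scalerA.
Qed.

(** The six monomials X_i X_j with i <= j have distinct exponents, so a form determines its
    coefficient vector. *)
Lemma mcoeff_qform (a : 'rV[F]_6) k :
  (qform a)@_(U_(idx_row k) + U_(idx_col k)) = a 0 k.
Proof.
rewrite raddf_sum (bigD1 k) //= big1 => [|l /eqP ne_lk]; rewrite mcoeffZ -mpolyXD mcoeffX.
  by rewrite eqxx mulr1 addr0.
case: eqP => [e|_]; last by rewrite mulr0.
have {e}e i : (U_(idx_row l) + U_(idx_col l))%MM i =
             (U_(idx_row k) + U_(idx_col k))%MM i by rewrite e.
case: ne_lk; move: (e 0) (e 1) (e 2) => {e}.
rewrite !mnmDE !mnm1E.
by move: k l; do 2![apply: forall_ord6];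
  rewrite !idx_row_idx // !idx_col_idx //.
Qed.

Lemma qform_inj : injective (@qform F).
Proof. by move=> a a' e; apply/rowP => k; rewrite -!mcoeff_qform e. Qed.

End QuadraticForms.

Lemma map_qform (F E : finFieldType) (iota : {rmorphism F -> E}) (a : 'rV[F]_6) :
  map_mpoly iota (qform a) = qform (map_mx iota a).
Proof.
rewrite rmorph_sum; apply: eq_bigr => k _ /=.
by rewrite map_mpolyZ rmorphM /= !map_mpolyX mxE.
Qed.

Section Predicates.
Variables (F E : finFieldType) (iota : {rmorphism F -> E}).

Lemma double_lineP (a : 'rV[F]_6) :
  reflect (exists c b, a = c *: pform b b) (double_line (qform a)).
Proof.
apply: (iffP existsP) => [[c /existsP[b]]|[c [b ->]]].
  rewrite expr2 lformM -qformZ => /eqP /qform_inj ->; by exists c, b.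
by exists c; apply/existsP; exists b; rewrite expr2 lformM -qformZ.
Qed.

Lemma real_line_pairP (a : 'rV[F]_6) :
  reflect (exists b b', ~~ proportional b b' /\ a = pform b b')
          (real_line_pair (qform a)).
Proof.
apply: (iffP existsP) => [[b /existsP[b' /andP[np]]]|[b [b' [np ->]]]].
  rewrite lformM => /eqP /qform_inj ->; by exists b, b'.
by exists b; apply/existsP; exists b'; rewrite np lformM /=.
Qed.

Lemma imaginary_line_pairP (a : 'rV[F]_6) :
  reflect (exists c b, ~~ proportional b (conj_form F b) /\
             map_mx iota a = iota c *: pform b (conj_form F b))
          (imaginary_line_pair iota (qform a)).
Proof.
apply: (iffP existsP) => [[c /existsP[b /andP[np]]]|[c [b [np e]]]].
  rewrite map_qform lformM -qformZ => /eqP /qform_inj ->; by exists c, b.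
by exists c; apply/existsP; exists b; rewrite np map_qform lformM -qformZ e /=.
Qed.

End Predicates.

(** Double counting, applied later to the scalar multiples that define one hyperplane and to the
    factorizations of one line pair. *)
Lemma card_uniform_fibres (T U : finType) (f : T -> U) (A : {set T}) n :
  (forall x, x \in A -> #|[set y in A | f y == f x]| = n) ->
  #|A| = (#|f @: A| * n)%N.
Proof.
move=> fibre; rewrite -sum1_card (partition_big_imset f) /=.
rewrite -sum_nat_const; apply: eq_bigr => _ /imsetP[x Ax ->].
by rewrite sum1dep_card (fibre x Ax).
Qed.

(** * The action of GL(3,q) on conics *)

Section DualAction.

(* The transpose of congr_act A: it substitutes A X for X in the quadratic form a. *)
Definition form_act (R : comNzRingType) (A : 'M[R]_3) (a : 'rV[R]_6) : 'rV[R]_6 :=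
  \sum_k a 0 k *: pform (row (idx_row k) A) (row (idx_col k) A).

Lemma form_actE (R : comNzRingType) (A : 'M[R]_3) (a : 'rV[R]_6) l :
  form_act A a 0 l =
  \sum_k a 0 k * pform (row (idx_row k) A) (row (idx_col k) A) 0 l.
Proof. by rewrite summxE; apply: eq_bigr => k _; rewrite mxE. Qed.

Lemma form_act_pform (R : comNzRingType) (A : 'M[R]_3) (b b' : 'rV[R]_3) :
  form_act A (pform b b') = pform (b *m A) (b' *m A).
Proof.
apply/rowP => k; rewrite form_actE -(idxK k) sum_ord6 !idx_row_idx // !idx_col_idx //.
rewrite !pformE /= !mxE !sum_ord3.
case: ifP => _; ring.
Qed.

Lemma map_form_act (R S : comNzRingType) (f : {rmorphism R -> S}) A a :
  map_mx f (form_act A a) = form_act (map_mx f A) (map_mx f a).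
Proof.
apply/rowP => l; rewrite mxE !form_actE rmorph_sum; apply: eq_bigr => k _.
by rewrite rmorphM -!map_row -map_pform !mxE.
Qed.

Lemma form_actZ (R : comNzRingType) (A : 'M[R]_3) c a :
  form_act A (c *: a) = c *: form_act A a.
Proof. by rewrite scaler_sumr; apply: eq_bigr => k _; rewrite mxE scalerA. Qed.

Variable F : finFieldType.
Implicit Types (A B : 'M[F]_3) (a y : 'rV[F]_6).

(** Both sides are the sum over k of a_k times row i of A, M(y), and the transpose of row j of A,
    where (i, j) is the k-th index pair. The group laws of [form_act] then follow from those of
    [congr_act], since the pairing is nondegenerate. *)
Lemma form_act_dual A a y :
  \sum_k form_act A a 0 k * y 0 k = \sum_k a 0 k * congr_act A y 0 k.
Proof.
under eq_bigr do rewrite form_actE mulr_suml.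
rewrite exchange_big /=; apply: eq_bigr => k _.
under eq_bigr do rewrite -mulrA.
rewrite -mulr_sumr sum_pform; congr (_ * _); rewrite !mxE.
under [RHS]eq_bigr do rewrite mxE mulr_suml.
rewrite exchange_big; apply: eq_bigr => i _; apply: eq_bigr => j _.
by rewrite !mxE mulrAC.
Qed.

Lemma congr_act_comp A B y : congr_act A (congr_act B y) = congr_act (A *m B) y.
Proof.
rewrite /congr_act coord_ofK; last by rewrite !trmx_mul trmxK sym_of_sym mulmxA.
by rewrite trmx_mul !mulmxA.
Qed.

Lemma form_pairing_inj a a' :
  (forall y, \sum_k a 0 k * y 0 k = \sum_k a' 0 k * y 0 k) -> a = a'.
Proof.
move=> e; apply/rowP => l; have:= e (delta_mx 0 l).
do 2![rewrite (bigD1 l) //= big1 ?addr0 => [|k /negPf nkl];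
  last by rewrite mxE nkl andbF mulr0].
by rewrite !mxE !eqxx !mulr1.
Qed.

Lemma form_act_comp A B a : form_act B (form_act A a) = form_act (A *m B) a.
Proof.
by apply: form_pairing_inj => y; rewrite !form_act_dual congr_act_comp.
Qed.

Lemma form_act1 a : form_act 1%:M a = a.
Proof.
apply: form_pairing_inj => y; rewrite form_act_dual /congr_act.
by rewrite trmx1 mulmx1 mul1mx sym_ofK.
Qed.

Lemma form_actK A : A \in unitmx -> cancel (form_act A) (form_act (invmx A)).
Proof. by move=> uA a; rewrite form_act_comp mulmxV // form_act1. Qed.

Lemma form_act_eq0 A a : A \in unitmx -> (form_act A a == 0) = (a == 0).
Proof.
move=> uA; rewrite -(inj_eq (can_inj (form_actK uA)) a 0).
by congr (_ == _); rewrite -(scale0r 0) form_actZ !scale0r.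
Qed.

(** Replaces a translate of a line by the line itself, at the price of acting on the conic. *)
Lemma sub_hyperplane_act A a (U : {vspace 'rV[F]_6}) :
  (linfun (congr_act A) @: U <= hyperplane a)%VS =
  (U <= hyperplane (form_act A a))%VS.
Proof.
have mem v : (linfun (congr_act A) v \in hyperplane a) =
             (v \in hyperplane (form_act A a)).
  by rewrite !mem_hyperplane lfunE form_act_dual.
apply/subvP/subvP => [sub v Uv|sub _ /memv_imgP[v Uv ->]].
  by rewrite -mem sub // memv_img.
by rewrite mem sub.
Qed.

Lemma det_mx22 (R : comNzRingType) (N : 'M[R]_2) : \det N = N 0 0 * N 1 1 - N 0 1 * N 1 0.
Proof.
rewrite (expand_det_row _ 0) !big_ord_recl big_ord0 addr0 /cofactor !det_mx11 !mxE /=.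
rewrite expr0 expr1 mul1r mulN1r mulrN.
by congr (N _ _ * N _ _ - N _ _ * N _ _); apply: val_inj.
Qed.

Lemma det_mx33 (R : comNzRingType) (M : 'M[R]_3) :
  \det M = M 0 0 * (M 1 1 * M 2 2 - M 1 2 * M 2 1)
         - M 0 1 * (M 1 0 * M 2 2 - M 1 2 * M 2 0)
         + M 0 2 * (M 1 0 * M 2 1 - M 1 1 * M 2 0).
Proof.
rewrite (expand_det_row _ 0) sum_ord3 /cofactor.
rewrite !det_mx22 !mxE /= expr0 expr1 [(2 %% 3)%N]/= expr2 !mulN1r opprK !mul1r mulrN.
congr (_ * _ - _ * _ + _ * _); congr (M _ _ * M _ _ - M _ _ * M _ _);
  exact: val_inj.
Qed.

(** Twice the discriminant is the determinant of the symmetric matrix with entries 2 a_ii and a_ij,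
    which explains the factor; the check is a polynomial identity with integer coefficients and so
    covers characteristic 2. *)
Lemma conic_disc_act A a :
  conic_disc (form_act A a) = \det A ^+ 2 * conic_disc a.
Proof.
rewrite /conic_disc !form_actE !sum_ord6 !idx_row_idx // !idx_col_idx //.
rewrite !pformE /= !mxE det_mx33; ring.
Qed.

End DualAction.

(** * The Frobenius map of F and roots of quadratics *)

Section Frobenius.
Variables (F : finFieldType) (K : fieldType) (f : {rmorphism F -> K}).

Lemma rmorph_expf_card x : f x ^+ #|F| = f x.
Proof. by rewrite -rmorphXn expf_card. Qed.

Lemma exprD_card (x y : K) : (x + y) ^+ #|F| = x ^+ #|F| + y ^+ #|F|.
Proof.
have [p p_pr charFp] := finPcharP F.
apply: exprDn_pchar; rewrite (eq_pnat _ (fmorph_pchar f)) (eq_pnat _ (pcharf_eq charFp)).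
(* The order of [F] is a power of its characteristic, the additive group being elementary
   abelian. *)
by rewrite -cardsT; apply/abelem_pgroup/fin_ring_pchar_abelem.
Qed.

Lemma exprN_card (x : K) : (- x) ^+ #|F| = - x ^+ #|F|.
Proof.
apply/eqP; rewrite -addr_eq0 -exprD_card addNr expr0n.
by case: #|F| (finNzRing_gt1 F).
Qed.

Lemma exprB_card (x y : K) : (x - y) ^+ #|F| = x ^+ #|F| - y ^+ #|F|.
Proof. by rewrite exprD_card exprN_card. Qed.

(** X^q - X is the product of the X - c for c in [F], so in any extension its only roots are the
    images of elements of [F]. *)
Lemma expr_card_fixed (x : K) : x ^+ #|F| = x -> exists c, x = f c.
Proof.
move=> fix_x; have /eqP := congr1 (fun p => (map_poly f p).[x]) (finField_genPoly F).
rewrite /= rmorphB rmorphXn /= map_polyX !hornerE fix_x subrr rmorph_prod.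
rewrite horner_prod eq_sym => /prodf_eq0[c _].
rewrite rmorphB /= map_polyX map_polyC !hornerE subr_eq0 => /eqP ->.
by exists c.
Qed.

(** The q-th power map is additive and fixes the coefficients, so it sends r to one of the two roots
    r and -s - r. *)
Lemma frobenius_quadratic_root (s p : F) (r : K) : r ^+ 2 + f s * r + f p = 0 ->
  r ^+ #|F| = r \/ r ^+ #|F| = - f s - r.
Proof.
move=> rE; have rqE : (r ^+ #|F|) ^+ 2 + f s * r ^+ #|F| + f p = 0.
  rewrite -(rmorph_expf_card s) -(rmorph_expf_card p) exprAC -exprMn -!exprD_card rE.
  by rewrite expr0n; case: #|F| (finNzRing_gt1 F).
have /eqP : (r ^+ #|F| - r) * (r ^+ #|F| - (- f s - r)) = 0.
  by rewrite -[RHS](subrr 0) -{1}rqE -rE; ring.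
by rewrite mulf_eq0 !subr_eq0 => /orP[] /eqP; [left|right].
Qed.

End Frobenius.

(* In an algebraic closure the two roots are either both fixed or exchanged by the
   Frobenius map of F, so their q^2-th powers are themselves. *)
Lemma quadratic_root (F E : finFieldType) (iota : {rmorphism F -> E})
    (hE : #|E| = (#|F| ^ 2)%N) (s p : F) :
  exists r : E, r ^+ 2 + iota s * r + iota p = 0.
Proof.
have [K [g _]] := countable_algebraic_closure E.
pose h : {rmorphism F -> K} := g \o iota.
have [r rE] : exists r : K, r ^+ 2 + h s * r + h p = 0.
  (* The closed field property has the form r^2 = P 0 + P 1 * r, hence the negated coefficients. *)
  have [|r] := @solve_monicpoly K 2%N
    (fun i => if i == 0%N then - h p else - h s); first by [].
  rewrite big_ord_recl big_ord1 /= expr0 expr1 => e; exists r; rewrite e; ring.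
have fix_r : r ^+ #|E| = r.
  rewrite hE -mulnn exprM.
  case: (frobenius_quadratic_root rE) => e; first by rewrite !e.
  by rewrite e (exprB_card h) (exprN_card h) (rmorph_expf_card h) e; ring.
have [c rc] := expr_card_fixed g fix_r.
exists c; apply: (fmorph_inj g); rewrite rmorph0 -[RHS]rE rc.
by rewrite !rmorphD rmorphXn rmorphM.
Qed.

(** * Divisibility of products of linear forms *)

Section Factorization.

(** The columns of the cokernel of [b] span the points of the line b = 0, and the cokernel commutes
    with field extension; hence the witness can be chosen over the small field [F]. *)
Lemma map_kernel_witness (F K : fieldType) (f : {rmorphism F -> K}) n
    (b : 'rV[F]_n) (u : 'rV[K]_n) :
  ~~ (u <= map_mx f b)%MS -> exists2 p : 'cV_n, b *m p = 0 & u *m map_mx f p != 0.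
Proof.
rewrite submxE -map_cokermx => /eqP/rowP/eqfunP/forallPn[j uj].
exists (col j (cokermx b)); first by rewrite colE mulmxA mulmx_coker mul0mx.
apply: contraNneq uj; rewrite map_col colE mulmxA -colE => /matrixP/(_ 0 0).
by rewrite !mxE => ->.
Qed.

Lemma kernel_witness (K : fieldType) n (b u : 'rV[K]_n) :
  ~~ (u <= b)%MS -> exists2 p : 'cV_n, b *m p = 0 & u *m p != 0.
Proof.
have mapK m m' (M : 'M[K]_(m, m')) : map_mx idfun M = M.
  by apply/matrixP => i j; rewrite mxE.
rewrite -{1}[b]mapK => /(@map_kernel_witness _ _ idfun)[p bp].
by rewrite mapK; exists p.
Qed.

Variable K : fieldType.
Implicit Types b u v w : 'rV[K]_3.

Lemma pform_horner b (b' : 'rV_3) (p : 'cV[K]_3) :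
  \sum_k pform b b' 0 k * (p (idx_row k) 0 * p (idx_col k) 0) =
  (b *m p) 0 0 * (b' *m p) 0 0.
Proof.
rewrite sum_pform !mxE !sum_ord3.
rewrite !(idxC 1 0) !(idxC 2 0) !(idxC 2 1) !idx_row_idx // !idx_col_idx //; ring.
Qed.

(** Otherwise the line b = 0 has points x off u = 0 and y off v = 0. Since u v vanishes on that
    line, v x = u y = 0, so at x + y the product u v takes the value (u x)(v y), which is nonzero.
    This works over every field, however small. *)
Lemma pform_sub b (b' : 'rV_3) u v : pform b b' = pform u v -> (u <= b)%MS || (v <= b)%MS.
Proof.
move=> e; case: (boolP (u <= b)%MS) => //= /kernel_witness[x bx ux].
apply/negPn/negP => /kernel_witness[y b_y vy].
have uv0 (p : 'cV_3) : b *m p = 0 -> (u *m p) 0 0 * (v *m p) 0 0 = 0.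
  by move=> bp; rewrite -pform_horner -e pform_horner bp !mxE mul0r.
have nz (M : 'M[K]_1) : M != 0 -> M 0 0 != 0.
  by apply: contra => /eqP M0; apply/eqP/matrixP => i j; rewrite !ord1 M0 mxE.
have /eqP := uv0 x bx; rewrite mulf_eq0 (negPf (nz _ ux)) /= => /eqP vx.
have /eqP := uv0 y b_y; rewrite mulf_eq0 (negPf (nz _ vy)) orbF => /eqP uy.
have := uv0 (x + y); rewrite !mulmxDr bx b_y addr0 => /(_ erefl) /eqP.
rewrite !mxE in vx uy *; rewrite vx uy addr0 add0r mulf_eq0.
by have := nz _ ux; have := nz _ vy; rewrite !mxE => /negPf -> /negPf ->.
Qed.

(** If b_i is nonzero, the entry at (i, i) forces w_i = 0, and then the entries at (i, j) force
    every w_j = 0. *)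
Lemma pform_eq0 b w : (pform b w == 0) = (b == 0) || (w == 0).
Proof.
apply/idP/idP => [/eqP bw0|/orP[]/eqP->]; last 2 first.
- by rewrite -(scale0r 0) pformZl !scale0r.
- by rewrite -(scale0r 0) pformZr !scale0r.
have [//|/= /eqP/rowP/eqfunP/forallPn[i]] := eqVneq b 0; rewrite mxE => bi.
have /eqP := congr1 (fun a : 'rV_6 => a 0 (idx i i)) bw0.
rewrite /= pformE eqxx mxE mulf_eq0 (negPf bi) /= => /eqP wi.
apply/eqP/rowP => j; have [<-//|nij] := eqVneq i j; first by rewrite mxE.
have /eqP := congr1 (fun a : 'rV_6 => a 0 (idx i j)) bw0.
rewrite /= pformE (negPf nij) wi mulr0 addr0 mxE mulf_eq0 (negPf bi) /=.
by move/eqP ->; rewrite mxE.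
Qed.

End Factorization.

(** * Unique factorization of line pairs *)

Section Classes.
Variable F : finFieldType.

Lemma proportionalE (b b' : 'rV[F]_3) :
  proportional b b' = (b <= b')%MS || (b' <= b)%MS.
Proof.
apply/existsP/orP => [[c /orP[]/eqP->]|[]/sub_rVP[c ->]].
- by left; apply: scalemx_sub.
- by right; apply: scalemx_sub.
- by exists c; rewrite eqxx.
- by exists c; rewrite eqxx orbT.
Qed.

Lemma proportional_neq0 (b b' : 'rV[F]_3) :
  ~~ proportional b b' -> (b != 0) && (b' != 0).
Proof.
by rewrite proportionalE -negb_or; apply: contra => /orP[]/eqP->; rewrite sub0mx ?orbT.
Qed.

(** By [pform_sub] one of u, v is a multiple of b; cancelling b by [pform_eq0] determines the other
    one. *)
Lemma pform_factors (b b' u v : 'rV[F]_3) : ~~ proportional b b' ->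
  (pform u v = pform b b') <->
  (exists2 k : F, k != 0 & (u, v) = (k *: b, k^-1 *: b') \/
                           (u, v) = (k *: b', k^-1 *: b)).
Proof.
move=> /proportional_neq0/andP[nz_b nz_b']; split; last first.
  case=> k nz_k [] [-> ->]; rewrite pformZl pformZr scalerA mulfV ?scale1r //.
  exact: pformC.
have main (u' v' : 'rV[F]_3) k : pform u' v' = pform b b' -> u' = k *: b ->
    k != 0 /\ v' = k^-1 *: b'.
  move=> e u'E; have /eqP : pform b (k *: v' - b') = 0.
    by rewrite pformBr pformZr -pformZl -u'E e subrr.
  rewrite pform_eq0 (negPf nz_b) subr_eq0 /= => /eqP kv.
  have nz_k : k != 0.
    by apply: contraNneq nz_b' => k0; rewrite -kv k0 scale0r.
  by rewrite nz_k -kv scalerA mulVf ?scale1r.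
move=> e; have /orP[] := pform_sub (esym e) => /sub_rVP[k kE].
  by have [nz_k ->] := main u v k e kE; exists k => //; left; rewrite kE.
have [|nz_k ->] := main v u k _ kE; first by rewrite pformC.
by exists k^-1; rewrite ?invr_eq0 //; right; rewrite invrK kE.
Qed.

Lemma card_nonzero : #|[set k : F | k != 0]| = #|F|.-1.
Proof.
by rewrite -[RHS](cardC1 (0 : F)) cardsE; apply: eq_card => x; rewrite !inE.
Qed.

(** There are q - 1 scalars and two orders of the factors; non-proportionality makes all these
    factorizations distinct. *)
Lemma card_pform_fibre (b b' : 'rV[F]_3) : ~~ proportional b b' ->
  #|[set p : 'rV[F]_3 * 'rV[F]_3 | pform p.1 p.2 == pform b b']| = (2 * #|F|.-1)%N.
Proof.
move=> np; have /andP[nz_b nz_b'] := proportional_neq0 np.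
pose g (kc : F * bool) :=
  if kc.2 then (kc.1 *: b, kc.1^-1 *: b') else (kc.1 *: b', kc.1^-1 *: b).
have -> : [set p : 'rV[F]_3 * 'rV[F]_3 | pform p.1 p.2 == pform b b'] =
          g @: setX [set k | k != 0] setT.
  apply/setP => -[u v]; rewrite inE /=; apply/eqP/imsetP.
    case/(pform_factors _ _ np) => k nz_k [] e.
      by exists (k, true) => //; rewrite !inE nz_k.
    by exists (k, false) => //; rewrite !inE nz_k.
  case=> -[k c]; rewrite !inE andbT /= => nz_k e; apply/(pform_factors _ _ np).
  by exists k => //; rewrite e /g; case: c {e}; [left | right].
rewrite card_in_imset; first by rewrite cardsX cardsT card_bool card_nonzero mulnC.
have cancelZ (w : 'rV[F]_3) (k l : F) : w != 0 -> k *: w = l *: w -> k = l.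
  move=> nz_w /eqP; rewrite -subr_eq0 -scalerBl scaler_eq0 (negPf nz_w) orbF.
  by rewrite subr_eq0 => /eqP.
have bad k l : k != 0 -> k *: b = l *: b' -> False.
  move=> nz_k e; case/negP: np; apply/existsP; exists (k^-1 * l).
  by rewrite -scalerA -e scalerA mulVf // scale1r eqxx.
move=> [k c] [l d]; rewrite !inE !andbT /g /= => nz_k nz_l.
case: c d => -[] [e1 e2].
- by rewrite (cancelZ _ _ _ nz_b e1).
- by case: (bad _ _ nz_k e1).
- by case: (bad _ _ nz_l (esym e1)).
- by rewrite (cancelZ _ _ _ nz_b' e1).
Qed.

End Classes.

Lemma conic_disc_pform (F : finFieldType) (b b' : 'rV[F]_3) : conic_disc (pform b b') = 0.
Proof. rewrite /conic_disc !pformE /=; ring. Qed.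

Lemma conic_discZ (F : finFieldType) k (a : 'rV[F]_6) :
  conic_disc (k *: a) = k ^+ 3 * conic_disc a.
Proof. rewrite /conic_disc !mxE; ring. Qed.

(** * Invariance and disjointness of the four classes *)

Section Invariance.
Variables (F E : finFieldType) (iota : {rmorphism F -> E}).
Implicit Types (a : 'rV[F]_6) (A : 'M[F]_3).

Lemma conic_disc_map a : conic_disc (map_mx iota a) = iota (conic_disc a).
Proof.
by rewrite /conic_disc !mxE !rmorphB !rmorphD /= !rmorphM /= rmorph_nat.
Qed.

Lemma proportional_mul (K : finFieldType) (b b' : 'rV[K]_3) (A : 'M[K]_3) :
  A \in unitmx -> proportional (b *m A) (b' *m A) = proportional b b'.
Proof. by move=> uA; rewrite !proportionalE !submxMfree // row_free_unit. Qed.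

(** Entries of [A] lie in [F], so conjugation fixes them. The left side spells out the conjugation
    because [n] is also taken to be 1, with [A] a point of the plane. *)
Lemma frobenius_mul n (b : 'rV[E]_3) (A : 'M[F]_(3, n)) :
  map_mx (fun x => x ^+ #|F|) (b *m map_mx iota A) = conj_form F b *m map_mx iota A.
Proof.
apply/rowP => j; rewrite !mxE !sum_ord3 !mxE !(exprD_card iota) !exprMn.
by rewrite !(rmorph_expf_card iota).
Qed.

Lemma conj_formZ k (b : 'rV[E]_3) :
  conj_form F (k *: b) = k ^+ #|F| *: conj_form F b.
Proof. by apply/rowP => j; rewrite !mxE exprMn. Qed.

Lemma double_line_act A a :
  double_line (qform a) -> double_line (qform (form_act A a)).
Proof.
case/double_lineP => c [b ->]; apply/double_lineP.
by exists c, (b *m A); rewrite form_actZ form_act_pform.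
Qed.

Lemma real_line_pair_act A a : A \in unitmx ->
  real_line_pair (qform a) -> real_line_pair (qform (form_act A a)).
Proof.
move=> uA /real_line_pairP[b [b' [np ->]]]; apply/real_line_pairP.
by exists (b *m A), (b' *m A); rewrite form_act_pform proportional_mul.
Qed.

Lemma imaginary_line_pair_act A a : A \in unitmx ->
  imaginary_line_pair iota (qform a) ->
  imaginary_line_pair iota (qform (form_act A a)).
Proof.
move=> uA /imaginary_line_pairP[c [b [np e]]]; apply/imaginary_line_pairP.
exists c, (b *m map_mx iota A); rewrite {1 2}/conj_form frobenius_mul.
rewrite proportional_mul ?map_unitmx //; split=> //.
by rewrite map_form_act e form_actZ form_act_pform.
Qed.

Lemma double_line_scale k a : double_line (qform a) -> double_line (qform (k *: a)).
Proof.
case/double_lineP => c [b ->]; apply/double_lineP.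
by exists (k * c), b; rewrite scalerA.
Qed.

Lemma real_line_pair_scale k a : k != 0 ->
  real_line_pair (qform a) -> real_line_pair (qform (k *: a)).
Proof.
move=> nz_k /real_line_pairP[b [b' [np ->]]]; apply/real_line_pairP.
exists (k *: b), b'; rewrite pformZl; split=> //; apply: contra np.
by rewrite !proportionalE !eqmx_scale.
Qed.

Lemma imaginary_line_pair_scale k a :
  imaginary_line_pair iota (qform a) -> imaginary_line_pair iota (qform (k *: a)).
Proof.
case/imaginary_line_pairP=> [c [b [np e]]]; apply/imaginary_line_pairP.
by exists (k * c), b; rewrite map_mxZ e scalerA rmorphM.
Qed.

Lemma double_line_not_real a :
  double_line (qform a) -> ~~ real_line_pair (qform a).
Proof.
case/double_lineP=> c [b ->]; apply/negP => /real_line_pairP[u [v [np]]].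
rewrite -pformZl => /(pform_factors _ _ np)[k nz_k].
case=> -[cb bE]; case/negP: np; rewrite proportionalE.
  rewrite -(eqmx_scale u nz_k) -cb bE; apply/orP; left.
  by do 2!apply: scalemx_sub.
rewrite orbC -(eqmx_scale v nz_k) -cb bE; apply/orP; left.
by do 2!apply: scalemx_sub.
Qed.

(** If b is not a multiple of u, some point p over [F] has u p = 0 and b p nonzero, whereas c (b p)
    (b p)^q = (u p)(v p) = 0. So b is a multiple of the form u over [F], and then so is its
    conjugate, against non-proportionality. *)
Lemma imaginary_line_pair_irreducible a (u v : 'rV[F]_3) :
  a != 0 -> imaginary_line_pair iota (qform a) -> a != pform u v.
Proof.
move=> nz_a /imaginary_line_pairP[c [b [np e]]]; apply/eqP => auv.
have nz_c : iota c != 0.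
  by apply: contraNneq nz_a => c0; rewrite -(map_mx_eq0 iota) e c0 scale0r.
case/negP: np; suff /sub_rVP[k ->] : (b <= map_mx iota u)%MS.
  rewrite proportionalE conj_formZ.
  have -> : conj_form F (map_mx iota u) = map_mx iota u.
    by apply/rowP => j; rewrite !mxE (rmorph_expf_card iota).
  have [->|nz_k] := eqVneq k 0; first by rewrite scale0r sub0mx.
  by rewrite (eqmx_scale _ nz_k) orbC scalemx_sub // eqmx_scale.
apply/negPn/negP => /map_kernel_witness[p up].
have /eqP := pform_horner b (iota c *: conj_form F b) (map_mx iota p).
rewrite pformZr -e auv map_pform pform_horner -map_mxM up.
rewrite map_mx0 [X in X * _ == _]mxE mul0r -scalemxAl -frobenius_mul.
rewrite [X in _ * X]mxE [X in _ * (_ * X)]mxE eq_sym !mulf_eq0 (negPf nz_c).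
rewrite expf_eq0 /= => bp0 /negP[]; apply/eqP/matrixP => i j.
by rewrite !ord1 [RHS]mxE; case/orP: bp0 => [|/andP[_]] /eqP.
Qed.

(** Disjointness is phrased as a sum of booleans so that it can be summed over all conics through
    the line. *)
Lemma classes_disjoint a : a != 0 ->
  (double_line (qform a) + real_line_pair (qform a)
   + imaginary_line_pair iota (qform a) + (conic_disc a != 0)%R <= 1)%N.
Proof.
move=> nz_a; case: (boolP (imaginary_line_pair iota (qform a))) => [im|_].
  have irr := imaginary_line_pair_irreducible _ _ nz_a im.
  have [/double_lineP[c [b e]]|_] := boolP (double_line (qform a)).
    by have := irr (c *: b) b; rewrite pformZl -e eqxx.
  have [/real_line_pairP[b [b' [_ e]]]|_] := boolP (real_line_pair (qform a)).
    by have := irr b b'; rewrite -e eqxx.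
  case/imaginary_line_pairP: im => c [b [_ e]].
  by rewrite -(fmorph_eq0 iota) -conic_disc_map e conic_discZ conic_disc_pform mulr0 eqxx.
have [dl|_] := boolP (double_line (qform a)).
  rewrite (negPf (double_line_not_real dl)); case/double_lineP: dl => c [b ->].
  by rewrite conic_discZ conic_disc_pform mulr0 eqxx.
have [/real_line_pairP[b [b' [_ ->]]]|_] := boolP (real_line_pair (qform a)).
  by rewrite conic_disc_pform eqxx.
by case: eqP.
Qed.

End Invariance.

(** * From hyperplanes to coefficient vectors *)

Section Hyperplanes.
Variable F : finFieldType.
Implicit Types (a : 'rV[F]_6) (P : pred 'rV[F]_6) (U : {vspace 'rV[F]_6}).

Lemma hyperplane_eqP a a' : a != 0 -> a' != 0 ->
  reflect (exists2 k, k != 0 & a' = k *: a) (hyperplane a' == hyperplane a).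
Proof.
move=> nz_a nz_a'; apply: (iffP eqP) => [e|[k nz_k ->]].
  have /sub_rVP[k kE] : (a' <= a)%MS.
    apply/negPn/negP => /kernel_witness[p ap] /negP[].
    have mem (c : 'rV_6) : (p^T \in hyperplane c) = (c *m p == 0).
      by rewrite memv_ker lfunE /= -trmx_mul trmx_eq0.
    by rewrite -mem e mem ap.
  by exists k => //; apply: contraNneq nz_a' => k0; rewrite kE k0 scale0r.
apply/vspaceP => v; rewrite !mem_hyperplane.
under eq_bigr do rewrite mxE -mulrA.
by rewrite -mulr_sumr mulf_eq0 (negPf nz_k).
Qed.

(** Each hyperplane is defined by exactly q - 1 nonzero vectors, the multiples of one of them, and
    [P] does not distinguish these. *)
Lemma card_hyperplanes P U :
    (forall k a, k != 0 -> P a -> P (k *: a)) ->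
  #|[set a | [&& a != 0, P a & (U <= hyperplane a)%VS]]| =
  (#|[set h in [set hyperplane a | a : 'rV_6 & (a != 0)%R && P a] | (U <= h)%VS]|
   * #|F|.-1)%N.
Proof.
move=> PZ; rewrite (card_uniform_fibres (f := @hyperplane F) (n := #|F|.-1)).
  congr (_ * _)%N; apply: eq_card => h; rewrite [RHS]inE.
  apply/imsetP/andP => [[a]|[/imsetP[a]]].
    rewrite inE => /and3P[nz_a Pa Ua] ->; split=> //.
    by apply/imsetP; exists a; rewrite // inE nz_a.
  by rewrite inE => /andP[nz_a Pa] -> Ua; exists a; rewrite // inE nz_a Pa.
move=> a; rewrite inE => /and3P[nz_a Pa Ua].
rewrite -(card_nonzero F) -(card_imset _ (f := fun k => k *: a)); last first.
  move=> k l /eqP; rewrite -subr_eq0 -scalerBl scaler_eq0 (negPf nz_a) orbF.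
  by rewrite subr_eq0 => /eqP.
apply: eq_card => a'; rewrite !inE; apply/andP/imsetP => [[/and3P[nz_a' _ _]]|].
  by case/(hyperplane_eqP nz_a nz_a') => k nz_k ->; exists k; rewrite ?inE.
case=> k; rewrite inE => nz_k ->.
have nz_ka : k *: a != 0 by rewrite scaler_eq0 negb_or nz_k.
have e : hyperplane (k *: a) == hyperplane a by apply/hyperplane_eqP => //; exists k.
by rewrite nz_ka PZ // (eqP e).
Qed.

Lemma card_forms_act P U (A : 'M[F]_3) : A \in unitmx ->
    (forall a, P (form_act A a) = P a) ->
  #|[set a | [&& a != 0, P a & (linfun (congr_act A) @: U <= hyperplane a)%VS]]| =
  #|[set a | [&& a != 0, P a & (U <= hyperplane a)%VS]]|.
Proof.
move=> uA PA; rewrite -[RHS](card_preimset _ (can_inj (form_actK uA))).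
by apply: eq_card => a; rewrite !inE form_act_eq0 // PA sub_hyperplane_act.
Qed.

Lemma sub_line12_1 a :
  (line12_1 F <= hyperplane a)%VS = (a 0 (idx 0 1) == 0) && (a 0 (idx 1 2) == 0).
Proof.
have mem k : (delta_mx 0 k \in hyperplane a) = (a 0 k == 0).
  rewrite mem_hyperplane (bigD1 k) //= big1 => [|l /negPf nlk].
    by rewrite mxE !eqxx mulr1 addr0.
  by rewrite mxE nlk andbF mulr0.
by rewrite subv_add -!memvE !mem.
Qed.

End Hyperplanes.

(** * Conics through the standard line *)

Section Coordinates.

Definition row3 (R : nzRingType) (x y z : R) : 'rV[R]_3 := \row_j [:: x; y; z]`_j.

Lemma row3E (R : nzRingType) (x y z : R) :
  (row3 x y z 0 0 = x) * (row3 x y z 0 1 = y) * (row3 x y z 0 2 = z).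
Proof. by rewrite !mxE. Qed.

Lemma row3P (R : nzRingType) (b : 'rV[R]_3) : b = row3 (b 0 0) (b 0 1) (b 0 2).
Proof. by apply/rowP; apply: forall_ord3; rewrite !row3E. Qed.

Variable F : finFieldType.

(* The forms vanishing on line12_1: al X0^2 + be X0 X2 + ga X2^2 + e X1^2. *)
Definition line_form (t : F * F * F * F) : 'rV[F]_6 :=
  let: (al, be, ga, e) := t in \row_k [:: al; 0; be; e; 0; ga]`_k.

Lemma line_formE al be ga e : let a := line_form (al, be, ga, e) in
  (a 0 (idx 0 0) = al) * (a 0 (idx 0 1) = 0) * (a 0 (idx 0 2) = be) *
  (a 0 (idx 1 1) = e) * (a 0 (idx 1 2) = 0) * (a 0 (idx 2 2) = ga).
Proof. by rewrite /= !mxE !val_idx. Qed.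

Lemma line_formP (a : 'rV[F]_6) : a 0 (idx 0 1) = 0 -> a 0 (idx 1 2) = 0 ->
  a = line_form (a 0 (idx 0 0), a 0 (idx 0 2), a 0 (idx 2 2), a 0 (idx 1 1)).
Proof. by move=> a1 a4; apply/rowP; apply: forall_ord6; rewrite line_formE. Qed.

Lemma line_form_inj : injective line_form.
Proof.
move=> [[[al be] ga] e] [[[al' be'] ga'] e'] /rowP eq_a.
move: (eq_a (idx 0 0)) (eq_a (idx 0 2)) (eq_a (idx 2 2)) (eq_a (idx 1 1)).
by rewrite !line_formE => -> -> -> ->.
Qed.

Lemma line_form_eq0 t : (line_form t == 0) = (t == (0, 0, 0, 0)).
Proof.
rewrite -(inj_eq line_form_inj); congr (_ == _).
by apply/rowP; apply: forall_ord6; rewrite line_formE mxE.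
Qed.

Lemma card_line_forms (P : pred 'rV[F]_6) :
  #|[set a | [&& a != 0, P a & (line12_1 F <= hyperplane a)%VS]]| =
  #|[set t | (t != (0, 0, 0, 0)) && P (line_form t)]|.
Proof.
rewrite -(card_imset _ line_form_inj); apply: eq_card => a.
rewrite inE sub_line12_1; apply/and3P/imsetP => [[nz_a Pa /andP[/eqP a1 /eqP a4]]|].
  exists (a 0 (idx 0 0), a 0 (idx 0 2), a 0 (idx 2 2), a 0 (idx 1 1)).
    by rewrite inE -line_form_eq0 -line_formP // nz_a.
  exact: line_formP.
case=> -[[[al be] ga] e]; rewrite inE -line_form_eq0 => /andP[nz Pt] ->.
by rewrite !line_formE eqxx.
Qed.

Lemma conic_disc_line_form al be ga e :
  conic_disc (line_form (al, be, ga, e)) = e * (4%:R * al * ga - be ^+ 2).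
Proof. rewrite /conic_disc !line_formE; ring. Qed.

End Coordinates.

(** * Characteristic 2 and the parity of q *)

Lemma two_eq0 (F : finFieldType) : (2%:R == 0 :> F) = ~~ odd #|F|.
Proof.
have [p p_pr charFp] := finPcharP F.
have pF : p.-nat #|F| by rewrite -cardsT; apply/abelem_pgroup/fin_ring_pchar_abelem.
apply/idP/idP => [two0|].
  have : 2%N \in [pchar F] by rewrite inE.
  rewrite (pcharf_eq charFp) inE => /eqP p2.
  move: pF (finNzRing_gt1 F); rewrite -p2 => /p_natP[[|n] ->] //.
  by rewrite oddX.
rewrite -dvdn2 => /pnat_dvd/(_ pF); rewrite pnatE // inE => /eqP p2.
by have := pcharf0 charFp; rewrite -p2 => ->.
Qed.

(** For even q, the square of x^(q/2) is x^q = x. *)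
Lemma sqrt_char2 (F : finFieldType) (x : F) : 2%:R = 0 :> F -> exists y, x = y ^+ 2.
Proof.
move/eqP; rewrite two_eq0 => even_q; exists (x ^+ #|F|./2).
by rewrite -exprM muln2 halfK (negPf even_q) subn0 expf_card.
Qed.

(** * Singular conics through the standard line are degenerate *)

Section Coverage.
Variables (F E : finFieldType) (iota : {rmorphism F -> E}).
Hypothesis hE : #|E| = (#|F| ^ 2)%N.

Definition degenerate (a : 'rV[F]_6) := [|| double_line (qform a),
  real_line_pair (qform a) | imaginary_line_pair iota (qform a)].

(** If u - x v = k (u - y v), then (1 - k) u = (x - k y) v: k = 1 forces x = y, and any other k
    makes u a multiple of v. *)
Lemma proportional_pencil (K : finFieldType) (u v : 'rV[K]_3) x y :
  ~~ proportional u v -> x != y -> ~~ proportional (u - x *: v) (u - y *: v).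
Proof.
move=> np nxy; have /andP[_ nz_v] := proportional_neq0 np.
have main x' y' : x' != y' -> ~~ (u - x' *: v <= u - y' *: v)%MS.
  move=> nxy'; apply/negP => /sub_rVP[k eu].
  have e : (1 - k) *: u = (x' - k * y') *: v.
    apply/eqP; rewrite -subr_eq0; have := subrr (u - x' *: v); rewrite {2}eu => <-.
    by apply/eqP/rowP => j; rewrite !mxE; ring.
  have [k1|nk1] := eqVneq k 1.
    move/eqP: e; rewrite k1 subrr scale0r eq_sym mul1r scaler_eq0 subr_eq0.
    by rewrite (negPf nxy') (negPf nz_v).
  case/negP: np; rewrite proportionalE; apply/orP; left.
  have nz : 1 - k != 0 by rewrite subr_eq0 eq_sym.
  by rewrite -(eqmx_scale _ nz) e scalemx_sub.
by rewrite proportionalE negb_or !main // eq_sym.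
Qed.

(* A root r of X^2 + s X + p splits u^2 + s u v + p v^2 as (u - r v)(u + (s + r) v). *)
Lemma pencil_degenerate (u v : 'rV[F]_3) c s p : ~~ proportional u v -> c != 0 ->
  degenerate (c *: (pform u u + s *: pform u v + p *: pform v v)).
Proof.
move=> np nz_c; have [r rE] := quadratic_root iota hE s p.
have split (K : finFieldType) (w x : 'rV[K]_3) (s' p' r' : K) :
    r' ^+ 2 + s' * r' + p' = 0 ->
    pform w w + s' *: pform w x + p' *: pform x x =
    pform (w - r' *: x) (w - (- s' - r') *: x).
  move=> e; rewrite (_ : p' = - (r' ^+ 2 + s' * r')); last first.
    by apply/eqP; rewrite -addr_eq0 addrC e.
  apply/rowP => k; rewrite -(idxK k).
  have entries (a1 a2 a3 : 'rV[K]_6) x1 x2 l :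
      (a1 + x1 *: a2 + x2 *: a3) 0 l = a1 0 l + x1 * a2 0 l + x2 * a3 0 l.
    by rewrite !mxE.
  by rewrite entries !pformE !mxE; case: eqP => _; ring.
(* A root fixed by Frobenius lies in [F] and gives a double line or a real pair; otherwise the
   second root is r^q and the two factors are conjugate. *)
apply/or3P; have [fix_r|nfix_r] := eqVneq (r ^+ #|F|) r.
  have [r' r'E] := expr_card_fixed iota fix_r.
  have r'0 : r' ^+ 2 + s * r' + p = 0.
    by apply: (fmorph_inj iota); rewrite !rmorphD rmorphXn rmorphM rmorph0 /= -r'E.
  rewrite (split _ _ _ _ _ _ r'0).
  have [<-|neq] := eqVneq r' (- s - r').
    by constructor 1; apply/double_lineP; exists c, (u - r' *: v).
  constructor 2; apply: real_line_pair_scale => //; apply/real_line_pairP.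
  by do 2!eexists; split; first exact: (proportional_pencil np neq).
constructor 3; apply/imaginary_line_pairP; exists c, (map_mx iota u - r *: map_mx iota v).
have conjE : conj_form F (map_mx iota u - r *: map_mx iota v) =
             map_mx iota u - r ^+ #|F| *: map_mx iota v.
  apply/rowP => j.
  by rewrite !mxE (exprB_card iota) exprMn !(rmorph_expf_card iota).
have rqE : r ^+ #|F| = - iota s - r.
  by case: (frobenius_quadratic_root rE) nfix_r => // ->; rewrite eqxx.
rewrite conjE; split.
  apply: proportional_pencil; last by rewrite eq_sym.
  by move: np; rewrite !proportionalE !map_submx.
by rewrite rqE -(split _ _ _ _ _ _ rE) !map_mxZ !map_mxD !map_mxZ !map_pform.
Qed.

Lemma proportional_row3 (K : finFieldType) (u v : 'rV[K]_3) i j :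
  u 0 i * v 0 j != u 0 j * v 0 i -> ~~ proportional u v.
Proof.
apply: contra => /existsP[c /orP[]/eqP->]; rewrite !mxE; apply/eqP; ring.
Qed.

Lemma pencilE (c s p : F) (a1 a2 a3 : 'rV[F]_6) l :
  (c *: (a1 + s *: a2 + p *: a3)) 0 l = c * (a1 0 l + s * a2 0 l + p * a3 0 l).
Proof. by rewrite !mxE. Qed.

(** If e = 0, the form is binary in X0 and X2. Otherwise 4 al ga = be^2, so in odd characteristic
    the part in X0, X2 is a multiple of a square w^2 and the form is binary in w and X1.
    [pencil_degenerate] treats these binary forms once a leading coefficient is nonzero. *)
Lemma line_form_degenerate t :
  conic_disc (line_form t) = 0 -> degenerate (line_form t).
Proof.
case: t => [[[al be] ga] e]; rewrite conic_disc_line_form => /eqP.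
have np (x : F) : ~~ proportional (row3 1 0 x) (row3 0 1 0).
  by apply: (@proportional_row3 _ _ _ 0 1); rewrite !row3E mulr1 mul0r oner_eq0.
have np02 (x : F) : ~~ proportional (row3 1 0 x) (row3 0 0 1).
  by apply: (@proportional_row3 _ _ _ 0 2); rewrite !row3E mulr1 mulr0 oner_eq0.
have np21 : ~~ proportional (row3 0 0 (1 : F)) (row3 0 1 0).
  by apply: (@proportional_row3 _ _ _ 2 1); rewrite !row3E mulr1 mulr0 oner_eq0.
rewrite mulf_eq0 => /orP[/eqP -> | disc0].
  have [->|nz_al] := eqVneq al 0.
    have [->|nz_be] := eqVneq be 0.
      apply/orP; left; apply/double_lineP; exists ga, (row3 0 0 1).
      apply/rowP; apply: forall_ord6; rewrite [RHS]mxE pformE !row3E line_formE /=; ring.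
    (* Here the form is X2 (be X0 + ga X2). *)
    apply/or3P; constructor 2; apply/real_line_pairP.
    exists (row3 be 0 ga), (row3 0 0 1); split.
      apply: (@proportional_row3 _ _ _ 0 2); by rewrite !row3E mulr1 mulr0.
    apply/rowP; apply: forall_ord6; rewrite pformE !row3E line_formE /=; ring.
  rewrite (_ : line_form _ = al *: (pform (row3 1 0 0) (row3 1 0 0) +
    (be / al) *: pform (row3 1 0 0) (row3 0 0 1) +
    (ga / al) *: pform (row3 0 0 1) (row3 0 0 1))).
    exact: pencil_degenerate.
  by apply/rowP; apply: forall_ord6; rewrite line_formE pencilE !pformE !row3E /=; field.
(* In characteristic 2 the condition says be = 0, and all coefficients are squares, so the conic is
   a double line. *)
have [two0|nz_two] := eqVneq (2%:R : F) 0.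
  move: disc0; rewrite (natrM _ 2 2) two0 !mul0r sub0r oppr_eq0 expf_eq0 => /eqP ->.
  have [x ->] := sqrt_char2 al two0; have [y ->] := sqrt_char2 ga two0.
  have [z ->] := sqrt_char2 e two0.
  apply/orP; left; apply/double_lineP; exists 1, (row3 x z y).
  have dbl w : w + w = 0 :> F by rewrite -mulr2n -mulr_natl two0 mul0r.
  apply/rowP; apply: forall_ord6; rewrite [RHS]mxE pformE !row3E line_formE /= mul1r;
    by rewrite ?[_ * x]mulrC ?[z * _]mulrC ?dbl ?expr2.
have [al0|nz_al] := eqVneq al 0.
  move: disc0; rewrite al0 mulr0 mul0r sub0r oppr_eq0 expf_eq0 => /eqP ->.
  have [->|nz_ga] := eqVneq ga 0.
    apply/orP; left; apply/double_lineP; exists e, (row3 0 1 0).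
    apply/rowP; apply: forall_ord6; rewrite [RHS]mxE pformE !row3E line_formE /=; ring.
  rewrite (_ : line_form _ = ga *: (pform (row3 0 0 1) (row3 0 0 1) +
    0 *: pform (row3 0 0 1) (row3 0 1 0) +
    (e / ga) *: pform (row3 0 1 0) (row3 0 1 0))).
    exact: pencil_degenerate.
  by apply/rowP; apply: forall_ord6; rewrite line_formE pencilE !pformE !row3E /=; field.
have nz_four : 4%:R != 0 :> F by rewrite (natrM _ 2 2) mulf_neq0.
(* Completing the square: al X0^2 + be X0 X2 + ga X2^2 = al w^2. *)
pose w := row3 1 0 (be / (2%:R * al)).
rewrite (_ : line_form _ = al *: (pform w w + 0 *: pform w (row3 0 1 0) +
  (e / al) *: pform (row3 0 1 0) (row3 0 1 0))).
  exact: (pencil_degenerate _ _ (np _) nz_al).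
have -> : ga = be ^+ 2 / (4%:R * al).
  move: disc0; rewrite subr_eq0 => /eqP <-; field.
  by rewrite nz_al nz_four.
apply/rowP; apply: forall_ord6; rewrite line_formE pencilE !pformE !row3E /=;
  by field; rewrite ?nz_al ?nz_two ?nz_four.
Qed.

End Coverage.

(** * Counting non-singular conics and double lines *)

Section Counting.
Variable F : finFieldType.
Let q := #|F|.
Let T : finType := (F * F * F * F)%type.

(** In odd characteristic, a nonzero first coefficient leaves the middle one free and fixes the
    last; a zero first coefficient forces the middle one to be 0 and leaves the last free. In
    characteristic 2 the condition only says that the middle coefficient is 0. *)
Lemma card_binary_disc0 :
  #|[set g : F * F * F | 4%:R * g.1.1 * g.2 == g.1.2 ^+ 2]| = (q ^ 2)%N.
Proof.
have [two0|nz_two] := eqVneq (2%:R : F) 0.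
  pose h (p : F * F) := (p.1, 0 : F, p.2).
  rewrite -mulnn -card_prod -cardsT -(card_imset setT (f := h)); last first.
    by move=> [u v] [u' v'] [-> ->].
  apply: eq_card => -[[u w] v]; rewrite inE /= (natrM _ 2 2) two0 !mul0r eq_sym expf_eq0 /=.
  apply/eqP/imsetP => [->|[p _ [_ -> _]] //]; by exists (u, v).
have nz_four : 4%:R != 0 :> F by rewrite (natrM _ 2 2) mulf_neq0.
pose h (p : F * F) := if p.1 == 0 then (0 : F, 0 : F, p.2)
                      else (p.1, p.2, p.2 ^+ 2 / (4%:R * p.1)).
rewrite -mulnn -card_prod -cardsT -(card_imset setT (f := h)); last first.
  move=> [u v] [u' v']; rewrite /h /=.
  case: eqP => [->|nz_u]; case: eqP => [->|nz_u'] [] //.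
  - by move=> ->.
  - by move=> e *; case: nz_u'.
  - by move=> -> ->.
apply: eq_card => -[[u w] v]; rewrite inE /=; apply/eqP/imsetP => [e|[[x y] _]].
  have [u0|nz_u] := eqVneq u 0.
    exists (0, v) => //; rewrite /h eqxx u0; congr (_, _, _); apply/eqP.
    by rewrite -[w == 0](expf_eq0 w 2) -e u0 mulr0 mul0r.
  exists (u, w) => //; rewrite /h /= (negPf nz_u) -e; congr (_, _, _); field.
  by rewrite nz_u nz_four.
rewrite /h /=; case: ifP => [_ [-> -> ->]|/negbT nz_x [-> -> ->]].
  by rewrite mulr0 mul0r expr0n.
by field; rewrite nz_x nz_four.
Qed.

Lemma card_nonsingular :
  #|[set t : T | (t != (0, 0, 0, 0)) && (conic_disc (line_form t) != 0)]| =
  (q.-1 * (q ^ 3 - q ^ 2))%N.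
Proof.
have <- : #|~: [set g : F * F * F | 4%:R * g.1.1 * g.2 == g.1.2 ^+ 2]| = (q ^ 3 - q ^ 2)%N.
  by rewrite cardsCs setCK card_binary_disc0 !card_prod -/q -mulnA !expnS muln1.
rewrite mulnC.
rewrite -card_nonzero -cardsX; apply: eq_card => -[[[al be] ga] e].
rewrite !inE conic_disc_line_form mulf_eq0 negb_or subr_eq0 /=.
rewrite andb_idl; first by rewrite andbC.
by case/andP => nz_e _; apply: contraNneq nz_e => -[_ _ _ ->].
Qed.

(** In c b^2 the coefficients 2 c b_0 b_1 and 2 c b_1 b_2 must vanish, so, unless c = 0, either b_1
    = 0 or b_0 = b_2 = 0. *)
Lemma double_line_form_odd (al be ga e : F) : 2%:R != 0 :> F ->
  double_line (qform (line_form (al, be, ga, e))) =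
  ((al, be, ga) == (0, 0, 0)) || ((e == 0) && (4%:R * al * ga == be ^+ 2)).
Proof.
move=> nz_two; have nz_four : 4%:R != 0 :> F by rewrite (natrM _ 2 2) mulf_neq0.
apply/double_lineP/orP => [[c [b eq_b]]|].
  have entry k : line_form (al, be, ga, e) 0 k = c * pform b b 0 k.
    by rewrite eq_b mxE.
  have dbl (x y : F) : c * (x * y + y * x) = 0 -> [\/ c = 0, x = 0 | y = 0].
    rewrite (mulrC y) -mulr2n -mulr_natl => /eqP.
    rewrite !mulf_eq0 (negPf nz_two) /= => /or3P[]/eqP;
      by [constructor 1|constructor 2|constructor 3].
  move: (entry (idx 0 0)) (entry (idx 0 1)) (entry (idx 0 2))
        (entry (idx 1 1)) (entry (idx 1 2)) (entry (idx 2 2)).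
  rewrite !line_formE !pformE /= => -> /esym e01 -> -> /esym e12 ->.
  case: (dbl _ _ e01) => [->|b0|b1].
  - by left; rewrite !mul0r.
  - case: (dbl _ _ e12) => [->|b1|b2].
    + by left; rewrite !mul0r.
    + by right; rewrite b1 b0 !(mulr0, mul0r, addr0, expr0n) !eqxx.
    + by left; rewrite b0 b2 !(mulr0, mul0r, addr0).
  - by right; rewrite b1 !(mulr0, eqxx) /=; apply/eqP; ring.
case=> [/eqP[-> -> ->]|/andP[/eqP-> /eqP disc0]].
  exists e, (row3 0 1 0).
  by apply/rowP; apply: forall_ord6; rewrite [RHS]mxE pformE !row3E line_formE /=; ring.
have [al0|nz_al] := eqVneq al 0.
  move/eqP: disc0; rewrite al0 mulr0 mul0r eq_sym expf_eq0 => /eqP ->.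
  exists ga, (row3 0 0 1).
  by apply/rowP; apply: forall_ord6; rewrite [RHS]mxE pformE !row3E line_formE /=; ring.
have -> : ga = be ^+ 2 / (4%:R * al) by rewrite -disc0; field; rewrite nz_al nz_four.
exists al, (row3 1 0 (be / (2%:R * al))).
by apply/rowP; apply: forall_ord6; rewrite [RHS]mxE pformE !row3E line_formE /=; field;
  rewrite ?nz_al ?nz_two ?nz_four.
Qed.

(** In characteristic 2 a square has no mixed terms, and every form without mixed terms is a
    square. *)
Lemma double_line_form_even (al be ga e : F) : 2%:R = 0 :> F ->
  double_line (qform (line_form (al, be, ga, e))) = (be == 0).
Proof.
move=> two0; have dbl w : w + w = 0 :> F by rewrite -mulr2n -mulr_natl two0 mul0r.
apply/double_lineP/eqP => [[c [b eq_b]]|->].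
  have := congr1 (fun a : 'rV_6 => a 0 (idx 0 2)) eq_b.
  by rewrite /= line_formE mxE pformE /= [b 0 2 * _]mulrC dbl mulr0.
have [x ->] := sqrt_char2 al two0; have [y ->] := sqrt_char2 ga two0.
have [z ->] := sqrt_char2 e two0; exists 1, (row3 x z y).
apply/rowP; apply: forall_ord6; rewrite [RHS]mxE pformE !row3E line_formE /= mul1r;
  by rewrite ?[_ * x]mulrC ?[z * _]mulrC ?dbl ?expr2.
Qed.

Lemma card_double_odd : 2%:R != 0 :> F ->
  #|[set t : T | (t != (0, 0, 0, 0)) && double_line (qform (line_form t))]| =
  (q.-1 * (q + 2))%N.
Proof.
move=> nz_two.
pose Z := [set g : F * F * F | 4%:R * g.1.1 * g.2 == g.1.2 ^+ 2].
(* The disjoint cases: q - 1 multiples of X1^2, and q^2 - 1 nonzero binary forms of discriminant 0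
   with e = 0; together (q - 1)(q + 2). *)
have -> : [set t : T | (t != (0, 0, 0, 0)) && double_line (qform (line_form t))] =
    setX [set (0, 0, 0)] [set e | e != 0] :|: setX (Z :\ (0, 0, 0)) [set 0].
  apply/setP => -[[[al be] ga] e].
  rewrite !inE double_line_form_odd // !xpair_eqE /=.
  by case: (_ && (ga == 0)); case: (e == 0); case: (_ == be ^+ 2).
rewrite cardsU (_ : _ :&: _ = set0); last first.
  by apply/setP => -[g e]; rewrite !inE /=; case: (g == _); rewrite ?andbF.
rewrite !cardsX !cards1 card_nonzero cards0 subn0 mul1n muln1.
have := cardsD1 (0, 0, 0) Z; rewrite card_binary_disc0 -/q inE /= mulr0 expr0n eqxx.
by case: q (finNzRing_gt1 F) => // n _; move: #|_| => z /=; nia.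
Qed.

Lemma card_double_even : 2%:R = 0 :> F ->
  #|[set t : T | (t != (0, 0, 0, 0)) && double_line (qform (line_form t))]| =
  (q.-1 * (q ^ 2 + q + 1))%N.
Proof.
move=> two0.
pose S := setX (setX (setX [set: F] [set (0 : F)]) [set: F]) [set: F].
have cardS : #|S| = (q * 1 * q * q)%N by rewrite !cardsX !cardsT cards1.
have -> : [set t : T | (t != (0, 0, 0, 0)) && double_line (qform (line_form t))] =
    S :\ (0, 0, 0, 0).
  by apply/setP => -[[[al be] ga] e]; rewrite !inE double_line_form_even //= !andbT.
have := cardsD1 (0, 0, 0, 0) S; rewrite cardS !inE eqxx /=.
by case: q (finNzRing_gt1 F) => // n _; move: #|_| => z /=; nia.
Qed.

End Counting.

(** * Counting real line pairs through their factorizations *)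

Section RealLinePairs.
Variable F : finFieldType.
Let q := #|F|.

Let line_pairs := [set p : 'rV[F]_3 * 'rV[F]_3 |
  ~~ proportional p.1 p.2 & (line12_1 F <= hyperplane (pform p.1 p.2))%VS].

Lemma card_line_pairs :
  #|line_pairs| =
  (#|[set a : 'rV[F]_6 | [&& (a != 0)%R, real_line_pair (qform a)
                         & (line12_1 F <= hyperplane a)%VS]]|
   * (2 * q.-1))%N.
Proof.
pose f (p : 'rV[F]_3 * 'rV[F]_3) := pform p.1 p.2.
rewrite (card_uniform_fibres (f := f) (n := (2 * q.-1)%N)).
  congr (_ * _)%N; apply: eq_card => a; rewrite [RHS]inE.
  apply/imsetP/and3P => [[[b b']]|[_ /real_line_pairP[b [b' [np ->]]]] La].
    rewrite inE /= => /andP[np Lb] ->; split=> //; last first.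
      by apply/real_line_pairP; exists b, b'.
    by rewrite pform_eq0 negb_or; apply: proportional_neq0.
  by exists (b, b'); rewrite // inE np.
move=> [b b']; rewrite inE /= => /andP[np Lb].
rewrite -(card_pform_fibre np); apply: eq_card => -[u v]; rewrite !inE /f /=.
apply: andb_idl => /eqP e; rewrite e Lb andbT.
have [k nz_k] := (pform_factors u v np).1 e.
have nz_k1 : k^-1 != 0 by rewrite invr_eq0.
by move=> [] [-> ->]; move: np; rewrite !proportionalE !eqmx_scale // orbC.
Qed.

Lemma mem_line_pairs (b b' : 'rV[F]_3) : ((b, b') \in line_pairs) =
  [&& ~~ proportional b b', b 0 0 * b' 0 1 + b 0 1 * b' 0 0 == 0 &
      b 0 1 * b' 0 2 + b 0 2 * b' 0 1 == 0].
Proof. by rewrite inE sub_line12_1 !pformE. Qed.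

(** If b_1 = 0, the incidence conditions become b_0 b'_1 = b_2 b'_1 = 0, so b'_1 = 0 because b is
    nonzero. Non-proportionality then says that the rows (b_0, b_2) and (b'_0, b'_2) form an
    invertible matrix. *)
Lemma card_concurrent_line_pairs :
  #|[set p in line_pairs | p.1 0 1 == 0]| = (q * q.-1 ^ 2 * q.+1)%N.
Proof.
rewrite -card_GL_2.
pose h (A : {'GL_2[F]}) :=
  (row3 (GLval A 0 0) 0 (GLval A 0 1), row3 (GLval A 1 0) 0 (GLval A 1 1)).
rewrite -(card_imset _ (f := h)); last first.
  move=> A B [] /rowP e /rowP e'; apply/val_inj/matrixP.
  have e2 (i : 'I_2) : i = 0 \/ i = 1.
    by case: i => -[|[|//]] ?; [left|right]; apply: val_inj.
  move: (e 0) (e 2) (e' 0) (e' 2); rewrite !row3E => e00 e01 e10 e11 i j.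
  by case: (e2 i) => ->; case: (e2 j) => ->.
apply: eq_card => -[b b']; rewrite inE mem_line_pairs.
apply/andP/imsetP => [[/and3P[np /eqP e0 /eqP e2] /eqP b1]|[A _ [-> ->]]].
  have /andP[nz_b nz_b'] := proportional_neq0 np.
  have b'1 : b' 0 1 = 0.
    apply/eqP; apply: contraNT nz_b => nz_b'1; move/eqP: e0; move/eqP: e2.
    rewrite b1 !mul0r addr0 add0r !mulf_eq0 (negPf nz_b'1) !orbF => /eqP b2 /eqP b0.
    by apply/eqP/rowP; apply: forall_ord3; rewrite mxE.
  have nz_det : b 0 0 * b' 0 2 != b 0 2 * b' 0 0.
    apply: contra np => /eqP det0; apply/existsP.
    have [b0|nz_b0] := eqVneq (b 0 0) 0; last first.
      exists (b' 0 0 / b 0 0); apply/orP; right; apply/eqP/rowP.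
      apply: forall_ord3; rewrite mxE ?b1 ?b'1 ?mulr0 ?divfK //.
      by rewrite mulrAC [b' 0 0 * _]mulrC -det0 mulrC mulKf.
    have nz_b2 : b 0 2 != 0.
      apply: contraNneq nz_b => b2.
      by apply/eqP/rowP; apply: forall_ord3; rewrite mxE.
    exists (b' 0 2 / b 0 2); apply/orP; right; apply/eqP/rowP.
    apply: forall_ord3; rewrite mxE ?b1 ?b'1 ?b0 ?mulr0 ?divfK //.
    by apply/eqP; move/esym/eqP: det0; rewrite b0 mul0r mulf_eq0 (negPf nz_b2).
  pose M : 'M[F]_2 := \matrix_(i, j)
    (if i == 0 then [:: b 0 0; b 0 2] else [:: b' 0 0; b' 0 2])`_j.
  have uM : M \is a GRing.unit.
    by rewrite -[_ \is a _]/(M \in unitmx) unitmxE unitfE det_mx22 !mxE subr_eq0.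
  exists (FinRing.Unit uM) => //; rewrite /h /GLval /= !mxE /=.
  by rewrite {1}[b]row3P {1}[b']row3P b1 b'1.
have := GL_unit A; rewrite unitmxE unitfE det_mx22 subr_eq0 => nz.
rewrite !row3E !(mulr0, mul0r, addr0) eqxx; split=> //; rewrite !andbT.
by apply: (@proportional_row3 _ _ _ 0 2); rewrite !row3E.
Qed.

(** For b_1 nonzero the two incidence equations determine b'_0 and b'_2 from b'_1, with l = b'_1 /
    b_1; l = 0 would give b' = 0. *)
Lemma oblique_line_pairs_reflection (b b' : 'rV[F]_3) :
  (b, b') \in line_pairs -> b 0 1 != 0 ->
  exists2 l, l != 0 & b' = l *: row3 (- b 0 0) (b 0 1) (- b 0 2).
Proof.
rewrite mem_line_pairs => /and3P[np /eqP e0 /eqP e2] nz_b1.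
have /andP[_ nz_b'] := proportional_neq0 np.
have e : b' = (b' 0 1 / b 0 1) *: row3 (- b 0 0) (b 0 1) (- b 0 2).
  apply/rowP; apply: forall_ord3; rewrite mxE row3E ?divfK //.
    apply: (mulfI nz_b1); rewrite -[LHS]addr0 -[X in _ + X](subrr (b 0 0 * b' 0 1)).
    by rewrite addrA [_ + b 0 0 * _]addrC e0; field.
  apply: (mulfI nz_b1); rewrite -[LHS]addr0 -[X in _ + X](subrr (b 0 2 * b' 0 1)).
  by rewrite addrA e2; field.
exists (b' 0 1 / b 0 1) => //.
by apply: contraNneq nz_b' => l0; rewrite e l0 scale0r.
Qed.

(** In characteristic 2 the reflection is the identity, so b and b' would be proportional. *)
Lemma card_oblique_line_pairs_even : 2%:R = 0 :> F ->
  #|[set p in line_pairs | p.1 0 1 != 0]| = 0%N.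
Proof.
move=> two0; apply: eq_card0 => -[b b']; apply/negP; rewrite inE => /andP[bb' /= nz_b1].
have [l _ b'E] := oblique_line_pairs_reflection bb' nz_b1.
move: bb'; rewrite mem_line_pairs => /andP[np _].
case/negP: np; apply/existsP; exists l.
have opp x : - x = x :> F.
  by apply/eqP; rewrite eq_sym -addr_eq0 -mulr2n -mulr_natl two0 mul0r.
by rewrite b'E !opp -row3P eqxx orbT.
Qed.

(** The free data are (b_0, b_2), b_1 and the scalar l. The value (0, 0) is excluded because a
    multiple of X1 is fixed by the reflection; any other value gives a nonzero minor 2 l x b_1 with
    x = b_0 or x = b_2. *)
Lemma card_oblique_line_pairs_odd : 2%:R != 0 :> F ->
  #|[set p in line_pairs | p.1 0 1 != 0]| = ((q ^ 2).-1 * q.-1 ^ 2)%N.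
Proof.
move=> nz_two.
pose D := setX (setX ([set: F * F] :\ (0 : F, 0 : F)) [set y : F | y != 0])
               [set l : F | l != 0].
have <- : #|D| = ((q ^ 2).-1 * q.-1 ^ 2)%N.
  rewrite !cardsX card_nonzero -mulnA mulnn; congr (_ * _)%N.
  have := cardsD1 (0 : F, 0 : F) [set: F * F]; rewrite inE cardsT card_prod -/q mulnn.
  by move=> ->.
pose h (t : F * F * F * F) := let: (x, z, y, l) := t in
  (row3 x y z, l *: row3 (- x) y (- z)).
rewrite -(card_in_imset (f := h) (D := mem D)); last first.
  move=> [[[x z] y] l] [[[x' z'] y'] l']; rewrite !inE /= => /andP[/andP[_ nz_y] _] _.
  case=> /rowP e /rowP e'; move: (e 0) (e 1) (e 2) (e' 1); rewrite !mxE /=.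
  by move=> -> <- -> /(mulIf nz_y) ->.
apply: eq_card => -[b b']; rewrite inE; apply/andP/imsetP => /=.
  case=> bb' nz_b1; have [l nz_l b'E] := oblique_line_pairs_reflection bb' nz_b1.
  exists (b 0 0, b 0 2, b 0 1, l); last by rewrite /h -row3P -b'E.
  rewrite !inE /= nz_b1 nz_l !andbT; move: bb'; rewrite mem_line_pairs.
  case/andP=> np _; apply: contra np; rewrite xpair_eqE => /andP[/eqP b0 /eqP b2].
  by apply/existsP; exists l; rewrite b'E (_ : row3 _ _ _ = b) ?eqxx ?orbT //;
    apply/rowP; apply: forall_ord3; rewrite row3E ?b0 ?b2 ?oppr0.
case=> -[[[x z] y] l]; rewrite !inE /= xpair_eqE => /andP[/andP[nz_xz nz_y] nz_l] [-> ->].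
rewrite sub_line12_1 !pformE !mxE /= nz_y; split=> //.
apply/and3P; split; try by apply/eqP; ring.
have nz x' : x' != 0 -> x' * (l * y) != y * (l * - x').
  move=> nz_x'; rewrite -subr_eq0 (_ : _ - _ = 2%:R * x' * l * y); last by ring.
  by rewrite !mulf_neq0.
have [x0|nz_x] := eqVneq x 0.
  apply: (@proportional_row3 _ _ _ 2 1); rewrite !mxE /=; apply: nz.
  by move: nz_xz; rewrite x0 eqxx andbT.
by apply: (@proportional_row3 _ _ _ 0 1); rewrite !mxE /=; apply: nz.
Qed.

End RealLinePairs.

(** One factor q - 1 of [card_line_pairs] is cancelled, while the 2 from the order of the lines
    stays on the left to avoid a division. *)
Lemma card_real_line_pairs (F : finFieldType) (q := #|F|) :
  (#|[set a : 'rV[F]_6 | [&& (a != 0)%R, real_line_pair (qform a)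
                         & (line12_1 F <= hyperplane a)%VS]]| * 2 =
   q.-1 * (q * q.+1 + (if odd q then (q ^ 2).-1 else 0)))%N.
Proof.
apply/eqP; rewrite -(@eqn_pmul2r q.-1); last by rewrite -subn1 subn_gt0 finNzRing_gt1.
rewrite -mulnA -card_line_pairs.
pose S0 := [set p : 'rV[F]_3 * 'rV[F]_3 | p.1 0 1 == 0].
rewrite -(cardsID S0).
have -> : forall X : {set 'rV[F]_3 * 'rV[F]_3}, X :&: S0 = [set p in X | p.1 0 1 == 0].
  by move=> X; apply/setP => p; rewrite !inE.
have -> : forall X : {set 'rV[F]_3 * 'rV[F]_3}, X :\: S0 = [set p in X | p.1 0 1 != 0].
  by move=> X; apply/setP => p; rewrite !inE andbC.
rewrite card_concurrent_line_pairs -/q.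
case: ifP => [odd_q|/negbT even_q].
  rewrite card_oblique_line_pairs_odd ?two_eq0 ?negbK //; apply/eqP; rewrite -/q; ring.
rewrite card_oblique_line_pairs_even; last by apply/eqP; rewrite two_eq0.
by apply/eqP; ring.
Qed.

(** * Transfer to an arbitrary line of the orbit *)

Section Orbit.
Variables (F E : finFieldType) (iota : {rmorphism F -> E}).
Hypothesis hE : #|E| = (#|F| ^ 2)%N.
Let q := #|F|.

(** Each of the q^4 - 1 nonzero forms lies in exactly one class: at most one by [classes_disjoint],
    at least one by [line_form_degenerate]. *)
Lemma card_line_classes :
  (#|[set t : F * F * F * F | (t != (0, 0, 0, 0))%R &&
        double_line (qform (line_form t))]|
   + #|[set t : F * F * F * F | (t != (0, 0, 0, 0))%R &&
        real_line_pair (qform (line_form t))]|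
   + #|[set t : F * F * F * F | (t != (0, 0, 0, 0))%R &&
        imaginary_line_pair iota (qform (line_form t))]|
   + #|[set t : F * F * F * F | (t != (0, 0, 0, 0))%R &&
        (conic_disc (line_form t) != 0)%R]|)%N
  = (q ^ 4).-1.
Proof.
have sumE (P : pred (F * F * F * F)) :
    #|[set t | (t != (0, 0, 0, 0))%R && P t]| = (\sum_(t | (t != (0, 0, 0, 0))%R) P t)%N.
  by rewrite -sum1dep_card big_mkcondr; apply: eq_bigr => t _; case: (P t).
rewrite !sumE -!big_split /= (eq_bigr (fun _ => 1%N)) => [|t nz_t].
  rewrite sum1_card (_ : q ^ 4 = q * q * q * q)%N; last by rewrite !expnS muln1 !mulnA.
  by rewrite -!card_prod -(cardC1 (0 : F, 0 : F, 0 : F, 0 : F)); apply: eq_card.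
apply/eqP; rewrite eqn_leq classes_disjoint ?line_form_eq0 //=.
case: eqP => [disc0|]; last by rewrite addn1.
have := line_form_degenerate iota hE disc0; rewrite /degenerate.
by case: double_line; case: real_line_pair; case: imaginary_line_pair.
Qed.

Variables (A : 'M[F]_3) (uA : A \in unitmx).
Let L := (linfun (congr_act A) @: line12_1 F)%VS.

Lemma card_class (P : pred 'rV[F]_6) :
    (forall k a, k != 0 -> P a -> P (k *: a)) ->
    (forall B a, B \in unitmx -> P a -> P (form_act B a)) ->
  (#|[set h in [set hyperplane a | a : 'rV_6 & (a != 0)%R && P a] | (L <= h)%VS]| * q.-1 =
   #|[set a : 'rV[F]_6 | [&& (a != 0)%R, P a & (line12_1 F <= hyperplane a)%VS]]|)%N.
Proof.
move=> PZ PA; rewrite -card_hyperplanes // card_forms_act // => a.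
apply/idP/idP => [Pa|]; last exact: PA.
(* One-sided invariance suffices, since it also applies to the inverse matrix. *)
by rewrite -(form_actK uA a) PA // unitmx_inv.
Qed.

Lemma card_H1 : (#|[set h in H1 F | (L <= h)%VS]| * q.-1 =
  #|[set t : F * F * F * F | (t != (0, 0, 0, 0))%R &&
        double_line (qform (line_form t))]|)%N.
Proof.
rewrite -(card_line_forms (fun a => double_line (qform a))).
apply: (card_class (P := fun a => double_line (qform a))).
  by move=> k a _; apply: double_line_scale.
by move=> B a _; apply: double_line_act.
Qed.

Lemma card_H2r : (#|[set h in H2r F | (L <= h)%VS]| * q.-1 =
  #|[set a : 'rV[F]_6 | [&& (a != 0)%R, real_line_pair (qform a)
                         & (line12_1 F <= hyperplane a)%VS]]|)%N.
Proof.
apply: (card_class (P := fun a => real_line_pair (qform a))).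
  exact: real_line_pair_scale.
exact: real_line_pair_act.
Qed.

Lemma card_H2i : (#|[set h in H2i iota | (L <= h)%VS]| * q.-1 =
  #|[set t : F * F * F * F | (t != (0, 0, 0, 0))%R &&
        imaginary_line_pair iota (qform (line_form t))]|)%N.
Proof.
rewrite -(card_line_forms (fun a => imaginary_line_pair iota (qform a))).
apply: (card_class (P := fun a => imaginary_line_pair iota (qform a))).
  by move=> k a _; apply: imaginary_line_pair_scale.
exact: imaginary_line_pair_act.
Qed.

Lemma card_H3 : (#|[set h in H3 F | (L <= h)%VS]| * q.-1 =
  #|[set t : F * F * F * F | (t != (0, 0, 0, 0))%R &&
        (conic_disc (line_form t) != 0)%R]|)%N.
Proof.
rewrite -(card_line_forms (fun a => conic_disc a != 0)).
apply: (card_class (P := fun a => conic_disc a != 0)).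
  by move=> k a nz_k nz_a; rewrite conic_discZ mulf_neq0 // expf_neq0.
move=> B a; rewrite unitmxE unitfE => nz_B nz_a.
by rewrite conic_disc_act mulf_neq0 // expf_neq0.
Qed.

End Orbit.

(** * Solving for the four numbers *)

Lemma solve_counts (q n1 nr ni n3 : nat) : (1 < q)%N ->
  (n1 * q.-1 = q.-1 * (if odd q then q + 2 else q ^ 2 + q + 1))%N ->
  (nr * q.-1 * 2 = q.-1 * (q * q.+1 + (if odd q then (q ^ 2).-1 else 0)))%N ->
  (n3 * q.-1 = q.-1 * (q ^ 3 - q ^ 2))%N ->
  (n1 * q.-1 + nr * q.-1 + ni * q.-1 + n3 * q.-1 = (q ^ 4).-1)%N ->
  [:: n1; nr; ni; n3] =
  if odd q then [:: q + 2; q ^ 2 + (q - 1) %/ 2;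
                    q ^ 2 - (q + 1) %/ 2; q ^ 3 - q ^ 2]%N
  else [:: q ^ 2 + q + 1; (q ^ 2 + q) %/ 2; (q ^ 2 - q) %/ 2; q ^ 3 - q ^ 2]%N.
Proof.
move=> q_gt1; have p_gt0 : (0 < q.-1)%N by rewrite -subn1 subn_gt0.
(* Dividing by q - 1 leaves the q^3 + q^2 + q + 1 hyperplanes through a line; the imaginary pairs
   are what remains of this total. *)
have q4 : ((q ^ 4).-1 = q.-1 * (q ^ 3 + q ^ 2 + q + 1))%N.
  case: q q_gt1 {p_gt0} => // p _; apply: succn_inj.
  by rewrite prednK ?expn_gt0 //= !expnS expn0; nia.
have cancel x y : (q.-1 * x = q.-1 * y)%N -> x = y.
  by move/eqP; rewrite eqn_pmul2l // => /eqP.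
move=> e1 er e3 tot.
have {}e1 := cancel _ _ (etrans (mulnC _ _) e1).
have {}e3 := cancel _ _ (etrans (mulnC _ _) e3).
have {}er : (nr * 2 = q * q.+1 + (if odd q then (q ^ 2).-1 else 0))%N.
  by apply: cancel; rewrite -er mulnA [(_ * nr)%N]mulnC.
have {}tot : (n1 + nr + ni + n3 = q ^ 3 + q ^ 2 + q + 1)%N.
  by apply: cancel; rewrite -q4 -tot -!mulnDl mulnC.
(* These bounds keep the truncated subtractions of the result exact. *)
have le12 : (q <= q ^ 2)%N by rewrite -mulnn leq_pmulr // ltnW.
have le23 : (q ^ 2 <= q ^ 3)%N by rewrite leq_exp2l.
(* Writing q as its parity plus twice its half lets [lia] evaluate the divisions by 2. *)
move: er (odd_double_half q); rewrite [(q * _)%N]mulnS mulnn.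
by case: (odd q) e1 => /= e1 er qE; congr [:: _; _; _; _]; lia.
Qed.

Theorem lemma4p9 (q : nat) (F E : finFieldType) (iota : {rmorphism F -> E})
    (hF : #|F| = q) (hE : #|E| = (q ^ 2)%N)
    (L : {vspace 'rV[F]_6}) (hL : L \in orbit12_1 F) :
  (odd q ->
     OD4 iota L = [:: q + 2; q ^ 2 + (q - 1) %/ 2;
                      q ^ 2 - (q + 1) %/ 2; q ^ 3 - q ^ 2]%N) /\
  (~~ odd q ->
     OD4 iota L = [:: q ^ 2 + q + 1; (q ^ 2 + q) %/ 2;
                      (q ^ 2 - q) %/ 2; q ^ 3 - q ^ 2]%N).
Proof.
case/imsetP: hL => A uA ->{L}; subst q.
have q_gt1 := finNzRing_gt1 F.
(* All counts of forms are rewritten as numbers of hyperplanes times q - 1, as [solve_counts]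
   expects. *)
have := card_line_classes iota hE.
have := card_real_line_pairs F; rewrite /= -(card_H2r uA).
rewrite -(card_line_forms (fun a => real_line_pair (qform a))) -(card_H2r uA).
rewrite -(card_H1 uA) -(card_H2i iota uA) -(card_H3 uA) /OD4 /=.
have := card_nonsingular F; rewrite -(card_H3 uA).
have c1o nz2 := etrans (card_H1 uA) (@card_double_odd F nz2).
have c1e nz2 := etrans (card_H1 uA) (@card_double_even F nz2).
have c1 : (#|[set h in H1 F | (linfun (congr_act A) @: line12_1 F <= h)%VS]| * #|F|.-1 =
    #|F|.-1 * (if odd #|F| then #|F| + 2 else #|F| ^ 2 + #|F| + 1))%N.
  by move: c1o c1e; case: (eqVneq (2%:R : F) 0) (two_eq0 F) => [two0|nz_two] odd_q c1o c1e;
    [rewrite (negPf (esym odd_q)) c1e|rewrite (negbFE (esym odd_q)) c1o].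
move=> n3E nrE tot; rewrite (solve_counts q_gt1 c1 nrE n3E tot).
by case: odd.
Qed.
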